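(* Let $u(t),B(t)\in U_h^{\mathrm{div}}$, $\rho(t)\in F_h$, $p(t)\in Q_h$ be a (time-differentiable) solution, for $t$ in a time interval $[0,T]$, of the semidiscrete method $$\langle \partial_t(\rho u),v\rangle + a_h(\rho u,u,v)-a_h(B,B,v)+\tfrac12 b_h(u\cdot u,\rho,v)=\langle p,\operatorname{div} v\rangle\quad \forall v\in U_h^{\mathrm{div}},$$ $$\langle \partial_t B,C\rangle + a_h(C,B,u)=0\quad\forall C\in U_h^{\mathrm{div}},$$ $$\langle \partial_t\rho,\sigma\rangle + b_h(\sigma,\rho,u)=0\quad\forall \sigma\in F_h,$$ $$\langle \operatorname{div} u,q\rangle=0\quad\forall q\in Q_h.$$ Then $\operatorname{div} u(t)\equiv 0$ in $\Omega$ for every $t$. Furthermore, if $B(0)$ is exactly divergence-free, then $\operatorname{div} B(t)\equiv 0$ in $\Omega$ for every $t$.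
   Context: $\Omega\subset\mathbb{R}^3$ is a bounded domain with unit normal $n$ on $\partial\Omega$, $\mathcal{T}_h$ is a (conforming simplicial) triangulation of $\Omega$, and $\mathcal{E}_h$ is the set of interior 2-dimensional faces of $\mathcal{T}_h$. For $K\in\mathcal{T}_h$, $P_s(K)$ denotes the polynomials of degree at most $s$ on $K$, and $x$ denotes the position vector. $\langle\cdot,\cdot\rangle$ is the $L^2(\Omega)$ inner product of scalar or vector fields. Set $H_0(\mathrm{div},\Omega)=\{u\in L^2(\Omega)^3: \operatorname{div}u\in L^2(\Omega),\ u\cdot n=0 \text{ on }\partial\Omega\}$, $H_0(\mathrm{curl},\Omega)=\{u\in L^2(\Omega)^3:\nabla\times u\in L^2(\Omega)^3,\ u\times n=0\text{ on }\partial\Omega\}$, $L^2_{\int=0}(\Omega)=\{f\in L^2(\Omega):\int_\Omega f\,dx=0\}$. Fix integers $s\ge 0$ and $m\ge0$ and define the finite element spaces $U_h^{\mathrm{div}}=\{u\in H_0(\mathrm{div},\Omega): u|_K\in P_s(K)^3+xP_s(K)\ \forall K\in\mathcal{T}_h\}$ (Raviart-Thomas), $U_h^{\mathrm{curl}}=\{u\in H_0(\mathrm{curl},\Omega): u|_K\in P_s(K)^3+x\times P_s(K)^3\ \forall K\in\mathcal{T}_h\}$ (Nedelec, first kind), $F_h=\{f\in L^2(\Omega): f|_K\in P_m(K)\ \forall K\in\mathcal{T}_h\}$, $Q_h=\{f\in L^2_{\int=0}(\Omega): f|_K\in P_s(K)\ \forall K\in\mathcal{T}_h\}$. On a face $e=K_1\cap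 K_2\in\mathcal{E}_h$, a piecewise smooth scalar $f$ with $f_i=f|_{K_i}$ has jump $[\![ f]\!]=f_1n_1+f_2n_2$ and average $\{f\}=\frac{f_1+f_2}{2}$, where $n_1$ is the unit normal to $e$ pointing from $K_1$ to $K_2$ and $n_2=-n_1$. Let $\pi_h^{\mathrm{curl}}:L^2(\Omega)^3\to U_h^{\mathrm{curl}}$ and $\pi_h:L^2(\Omega)\to F_h$ be the $L^2$-orthogonal projectors. The trilinear forms $a_h:L^2(\Omega)^3\times L^4(\Omega)^3\times L^4(\Omega)^3\to\mathbb{R}$ and $b_h:L^2(\Omega)\times L^2(\Omega)\times U_h^{\mathrm{div}}\to\mathbb{R}$ are $$a_h(w,u,v)=\int_\Omega w\cdot\nabla\times\pi_h^{\mathrm{curl}}(u\times v)\,dx,$$ $$b_h(f,g,u)=-\sum_{K\in\mathcal{T}_h}\int_K(u\cdot\nabla\pi_hf)\,\pi_hg\,dx+\sum_{e\in\mathcal{E}_h}\int_e u\cdot[\![ \pi_hf]\!]\{\pi_hg\}\,ds.$$ *)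

(* Defs.v *)
From HB Require Import structures.
From mathcomp Require Import all_boot all_order all_algebra.
From mathcomp Require Import all_classical all_reals all_analysis.
From mathcomp Require mpoly.

Set Implicit Arguments.
Unset Strict Implicit.
Unset Printing Implicit Defensive.

Import Order.TTheory GRing.Theory Num.Theory.
Import numFieldNormedType.Exports.
(* A full import would clash with notations of the analysis library. *)
Import (canonicals, coercions) mpoly.

Local Open Scope classical_set_scope.
Local Open Scope ring_scope.

Section VectorCalculus.
Context {R : realType}.
Implicit Types (x a b : 'rV[R]_3) (f : 'rV[R]_3 -> R)
  (u v : 'rV[R]_3 -> 'rV[R]_3).

Definition dot a b : R := \sum_(i < 3) a 0 i * b 0 i.

(* The library norm on 'rV[R]_3 is the sup norm. *)
Definition euclid a : R := Num.sqrt (dot a a).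

(* Indices 'I_3 are added modulo 3, here and in [curl]. *)
Definition cross a b : 'rV[R]_3 :=
  \row_i (a 0 (i + 1) * b 0 (i + 2) - a 0 (i + 2) * b 0 (i + 1)).

Definition partial (i : 'I_3) f : 'rV[R]_3 -> R :=
  fun x => 'D_(delta_mx 0 i) f x.

Definition grad f : 'rV[R]_3 -> 'rV[R]_3 := fun x => \row_i partial i f x.

Definition component v (i : 'I_3) : 'rV[R]_3 -> R := fun x => v x 0 i.

Definition curl v : 'rV[R]_3 -> 'rV[R]_3 := fun x =>
  \row_i (partial (i + 1) (component v (i + 2)) x
          - partial (i + 2) (component v (i + 1)) x).

(* C^oo(R^3): every iterated partial derivative is differentiable everywhere. *)
Definition smooth f : Prop :=
  forall (l : seq 'I_3) x, differentiable (foldr partial f l) x.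

Definition smoothv v : Prop := forall i, smooth (component v i).

(* P_s: polynomial functions of total degree at most s ([msize] is 1 + degree). *)
Definition polyfun (s : nat) : set ('rV[R]_3 -> R) :=
  [set f | exists2 p : mpoly.mpoly 3 R, (mpoly.msize p <= s.+1)%N
         & forall x, f x = mpoly.meval (fun i => x 0 i) p].

Definition polyfunv (s : nat) : set ('rV[R]_3 -> 'rV[R]_3) :=
  [set v | forall i, polyfun s (component v i)].

End VectorCalculus.

Section LebesgueSpaces.
Context {R : realType}.
Implicit Types (D Om : set 'rV[R]_3) (f g : 'rV[R]_3 -> R)
  (u v : 'rV[R]_3 -> 'rV[R]_3).

(* Lebesgue measure on R^3 lives on R * R * R, which is identified with
   'rV[R]_3 through [vec3]. *)
Definition leb3 : {measure set (measurableTypeR R * measurableTypeR R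
                                * measurableTypeR R) -> \bar R} :=
  (((@lebesgue_measure R \x @lebesgue_measure R) \x @lebesgue_measure R)%E).

Definition vec3 (c : R * R * R) : 'rV[R]_3 :=
  \row_(i < 3) nth 0 [:: c.1.1; c.1.2; c.2] i.

Definition volint D f : R := \int[leb3]_(c in vec3 @^-1` D) f (vec3 c).

Definition L2 Om f : Prop := (f \_ Om) \o vec3 \in Lfun leb3 2%:E.

Definition L2v Om v : Prop := forall i, L2 Om (component v i).

Definition L2norm Om f : \bar R :=
  Lnorm leb3 2%:E (EFin \o ((f \_ Om) \o vec3)).

Definition ip Om f g : R := volint Om (fun x => f x * g x).

Definition ipv Om u v : R := volint Om (fun x => dot (u x) (v x)).

(* [xget] picks a representative of an object that is determined up to a null
   set: here and below for projections, weak derivatives, time derivatives. *)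
Definition L2proj Om (W : set ('rV[R]_3 -> R)) f : 'rV[R]_3 -> R :=
  xget (fun=> 0)
    [set w | W w /\ forall g, W g -> ip Om (fun x => f x - w x) g = 0].

Definition L2projv Om (W : set ('rV[R]_3 -> 'rV[R]_3)) v :
    'rV[R]_3 -> 'rV[R]_3 :=
  xget (fun=> 0)
    [set w | W w /\ forall z, W z -> ipv Om (fun x => v x - w x) z = 0].

(* Test functions: smooth with compact support in Om. *)
Definition testfun Om f : Prop :=
  smooth f /\
  exists A, [/\ compact A, A `<=` Om & forall x, ~ A x -> f x = 0].

(* Distributional divergence and curl in L^2(Om). *)
Definition is_wdiv Om u (d : 'rV[R]_3 -> R) : Prop :=
  L2 Om d /\
  forall phi, testfun Om phi -> ipv Om u (grad phi) = - ip Om d phi.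

Definition is_wcurl Om u (c : 'rV[R]_3 -> 'rV[R]_3) : Prop :=
  L2v Om c /\
  forall phi, (forall i, testfun Om (component phi i)) ->
    ipv Om u (curl phi) = ipv Om c phi.

Definition wdiv Om u : 'rV[R]_3 -> R :=
  xget (fun=> 0) [set d | is_wdiv Om u d].

Definition wcurl Om u : 'rV[R]_3 -> 'rV[R]_3 :=
  xget (fun=> 0) [set c | is_wcurl Om u c].

(* The normal trace u.n of u in H(div) is the functional
     phi |-> \int_Om u . grad phi + (div u) phi,
   and the tangential trace u x n of u in H(curl) is
     phi |-> \int_Om u . curl phi - (curl u) . phi,
   where phi ranges over the restrictions to Om of smooth fields on R^3. *)
Definition H0div Om : set ('rV[R]_3 -> 'rV[R]_3) :=
  [set u | L2v Om u /\ exists d, is_wdiv Om u d /\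
     forall phi, smooth phi -> ipv Om u (grad phi) + ip Om d phi = 0].

Definition H0curl Om : set ('rV[R]_3 -> 'rV[R]_3) :=
  [set u | L2v Om u /\ exists c, is_wcurl Om u c /\
     forall phi, smoothv phi -> ipv Om u (curl phi) - ipv Om c phi = 0].

(* Time derivative at t in [0, T] of a curve in L^2(Om): limit in L^2(Om) of
   the difference quotients, one-sided at the end points. *)
Definition is_dt Om (T : R) (F : R -> 'rV[R]_3 -> R) (t : R) g : Prop :=
  L2 Om g /\
  L2norm Om (fun x => (r - t)^-1 * (F r x - F t x) - g x)
    @[r --> within [set r | 0 <= r <= T] t^'] --> 0%E.

Definition is_dtv Om (T : R) (F : R -> 'rV[R]_3 -> 'rV[R]_3) (t : R) v : Prop :=
  forall i, is_dt Om T (fun r => component (F r) i) t (component v i).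

Definition dt Om T (F : R -> 'rV[R]_3 -> R) t : 'rV[R]_3 -> R :=
  xget (fun=> 0) [set g | is_dt Om T F t g].

Definition dtv Om T (F : R -> 'rV[R]_3 -> 'rV[R]_3) t : 'rV[R]_3 -> 'rV[R]_3 :=
  xget (fun=> 0) [set v | is_dtv Om T F t v].

Definition dt_ex Om T (F : R -> 'rV[R]_3 -> R) : Prop :=
  forall t, 0 <= t <= T -> exists g, is_dt Om T F t g.

Definition dtv_ex Om T (F : R -> 'rV[R]_3 -> 'rV[R]_3) : Prop :=
  forall t, 0 <= t <= T -> exists v, is_dtv Om T F t v.

Definition bounded_domain Om : Prop :=
  [/\ open Om, connected Om, bounded_set Om & Om !=set0].

End LebesgueSpaces.

(* Finite simplicial meshes: a cell is a set of indices of vertices. *)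
Record mesh (R : realType) := Mesh {
  nvtx : nat;
  vtx : 'I_nvtx -> 'rV[R]_3;
  cells : {set {set 'I_nvtx}} }.

Section Meshes.
Context {R : realType}.
Implicit Types (M : mesh R) (Om : set 'rV[R]_3).

(* Convex hull of the vertices with index in A. *)
Definition hull M (A : {set 'I_(nvtx M)}) : set 'rV[R]_3 :=
  [set x | exists w : 'I_(nvtx M) -> R,
     [/\ forall i, 0 <= w i, \sum_(i in A) w i = 1
       & x = \sum_(i in A) w i *: vtx i]].

Definition affinely_free M (A : {set 'I_(nvtx M)}) : Prop :=
  forall w : 'I_(nvtx M) -> R,
    \sum_(i in A) w i = 0 -> \sum_(i in A) w i *: vtx i = 0 ->
    forall i, i \in A -> w i = 0.

(* The cells are nondegenerate tetrahedra, any two of which meet in the (possibly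
   empty) face spanned by their common vertices, and which fill the closure of
   Om. The last condition says that Om is on one side of its boundary (no
   slits). *)
Definition triangulation M Om : Prop :=
  [/\ forall K, K \in cells M -> #|K| = 4 /\ affinely_free K,
      forall K L, K \in cells M -> L \in cells M ->
        hull K `&` hull L = hull (K :&: L)%SET,
      closure Om = [set x | exists2 K, K \in cells M & hull K x]
    & (closure Om)° = Om].

Definition inside M (K : {set 'I_(nvtx M)}) : set 'rV[R]_3 := (hull K)°.

(* Interior faces e = K1 n K2, encoded by the pair (K1, K2); the two cells are
   listed in the order of [enum_rank], so that each face occurs once. *)
Definition int_faces M :
    {set {set 'I_(nvtx M)} * {set 'I_(nvtx M)}} :=
  [set F | [&& F.1 \in cells M, F.2 \in cells M, #|F.1 :&: F.2| == 3
             & (enum_rank F.1 < enum_rank F.2)%N]]%SET.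

Definition triangle_int (a b c : 'rV[R]_3) (g : 'rV[R]_3 -> R) : R :=
  euclid (cross (b - a) (c - a)) *
  \int[(@lebesgue_measure R \x @lebesgue_measure R)%E]_(q in
        [set q : R * R | [/\ 0 <= q.1, 0 <= q.2 & q.1 + q.2 <= 1]])
    g (a + q.1 *: (b - a) + q.2 *: (c - a)).

(* Surface integral over the triangle spanned by e, where #|e| = 3. *)
Definition faceint M (e : {set 'I_(nvtx M)}) (g : 'rV[R]_3 -> R) : R :=
  let vs := [seq vtx i | i <- enum e] in
  triangle_int vs`_0 vs`_1 vs`_2 g.

(* Unit normal to e = K1 n K2 pointing from K1 to K2. *)
Definition face_normal M (K1 K2 : {set 'I_(nvtx M)}) : 'rV[R]_3 :=
  xget 0 [set n | [/\ euclid n = 1,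
    forall y z, hull (K1 :&: K2)%SET y -> hull (K1 :&: K2)%SET z ->
      dot n (z - y) = 0
    & forall y z, hull (K1 :&: K2)%SET y -> hull K2 z -> 0 <= dot n (z - y)]].

(* Value at x of the restriction of f to K, for x in K. *)
Definition trace (V : normedModType R) M (K : {set 'I_(nvtx M)})
    (f : 'rV[R]_3 -> V) (x : 'rV[R]_3) : V :=
  lim (f y @[y --> within (inside K) (nbhs x)]).

Definition jump M (F : {set 'I_(nvtx M)} * {set 'I_(nvtx M)})
    (f : 'rV[R]_3 -> R) (x : 'rV[R]_3) : 'rV[R]_3 :=
  trace F.1 f x *: face_normal F.1 F.2
  + trace F.2 f x *: (- face_normal F.1 F.2).

Definition avg M (F : {set 'I_(nvtx M)} * {set 'I_(nvtx M)})
    (f : 'rV[R]_3 -> R) (x : 'rV[R]_3) : R :=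
  (trace F.1 f x + trace F.2 f x) / 2.

End Meshes.

Section Method.
Context {R : realType}.
Variables (Om : set 'rV[R]_3) (M : mesh R).

(* Finite element fields are represented by functions that are polynomial on the
   interior of each cell; their values on the (null) skeleton are irrelevant. *)
Definition U_div (s : nat) : set ('rV[R]_3 -> 'rV[R]_3) :=
  [set u | H0div Om u /\ forall K, K \in cells M ->
     exists p q, [/\ polyfunv s p, polyfun s q
       & forall x, inside K x -> u x = p x + q x *: x]].

Definition U_curl (s : nat) : set ('rV[R]_3 -> 'rV[R]_3) :=
  [set u | H0curl Om u /\ forall K, K \in cells M ->
     exists p q, [/\ polyfunv s p, polyfunv s q
       & forall x, inside K x -> u x = p x + cross x (q x)]].

Definition F_h (m : nat) : set ('rV[R]_3 -> R) :=
  [set f | L2 Om f /\ forall K, K \in cells M ->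
     exists2 p, polyfun m p & forall x, inside K x -> f x = p x].

Definition Q_h (s : nat) : set ('rV[R]_3 -> R) :=
  [set f | [/\ L2 Om f, volint Om f = 0
     & forall K, K \in cells M ->
         exists2 p, polyfun s p & forall x, inside K x -> f x = p x]].

Definition a_h (s : nat) (w u v : 'rV[R]_3 -> 'rV[R]_3) : R :=
  ipv Om w (wcurl Om (L2projv Om (U_curl s) (fun x => cross (u x) (v x)))).

(* On a face, u stands for its trace from the first cell: its normal component,
   the only one that occurs since the jump is normal to the face, is the same
   from both sides. *)
Definition b_h (m : nat) (f g : 'rV[R]_3 -> R) (u : 'rV[R]_3 -> 'rV[R]_3) : R :=
  let pf := L2proj Om (F_h m) f in
  let pg := L2proj Om (F_h m) g in
  - (\sum_(K in cells M)
       volint (inside K) (fun x => dot (u x) (grad pf x) * pg x))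
  + \sum_(F in int_faces M)
      faceint (F.1 :&: F.2)%SET
        (fun x => dot (trace F.1 u x) (jump F pf x) * avg F pg x).

End Method.

(* Main.v *)
From HB Require Import structures.
Require Import Defs.
From mathcomp Require Import all_boot all_order all_algebra.
From mathcomp Require Import all_classical all_reals all_analysis.
From mathcomp Require Import measurable_realfun.
From mathcomp Require Import ring lra.
From mathcomp Require mpoly.

Set Implicit Arguments.
Unset Strict Implicit.
Unset Printing Implicit Defensive.

Import Order.TTheory GRing.Theory Num.Theory.
Import numFieldNormedType.Exports.
Import (canonicals, coercions) mpoly.

Local Open Scope classical_set_scope.
Local Open Scope ring_scope.

(** Why the statement holds. Both divergences are controlled by testing the
equations with functions built from the solution itself.

On each cell the divergence of a Raviart-Thomas field is a polynomial of degree at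
most [s], and its integral over [Om] is zero because the normal trace vanishes.
The divergence of [u] therefore belongs to [Q_h] and is a legitimate test function
in the incompressibility equation, which says that its [L^2] norm is zero
([U_div_divfree]).

For [B], let [z] be the projection of [cross B u] onto [U_curl]. Its curl [c] is a
divergence-free element of [U_div] ([U_curl_curl]), and the induction equation says
that [dB/dt + c] is orthogonal to [U_div]. The difference quotients of [B] are in
[U_div], and adding [c] to them gives test functions that converge to [dB/dt + c];
hence [dB/dt = - c] ([induction_strong]). For every test function [phi], the
derivative in time of [(B, grad phi)] is then [- (c, grad phi) = 0], and
[(B, grad phi)] keeps its initial value 0 ([divfree_preserved]).

Most of the work lies in the passage between the two descriptions of the
derivatives of a finite element field: the distributional divergence or curl,
known only through pairings with test functions, and the classical derivative of
the polynomial on each cell. They agree against test functions supported in one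
cell, by integration by parts ([local_parts]). To extend this to all piecewise
smooth functions ([weak_null], [weak_glue]), these are multiplied by cut-off
functions of the cells ([cell_cutoff]), made of the function [exp (-1/t)] and of
barycentric coordinates, and the cut-off is removed by dominated convergence,
since the cells fill [Om] up to a null set ([skeleton_null]). The other
ingredients are the symmetry of second derivatives ([partial_comm]), for
[curl grad = 0], and Fubini's theorem on [R^3] ([integral_lines0]). *)

(** * Calculus of smooth and polynomial functions *)

Lemma ord3 (P : 'I_3 -> Prop) : P 0 -> P 1 -> P 2 -> forall i, P i.
Proof.
move=> P0 P1 P2 [[|[|[|n]]] Hn]//.
- by rewrite (_ : Ordinal Hn = 0)//; apply: val_inj.
- by rewrite (_ : Ordinal Hn = 1)//; apply: val_inj.
- by rewrite (_ : Ordinal Hn = 2)//; apply: val_inj.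
Qed.

Lemma ord3_lift : (lift ord0 ord0 = 1 :> 'I_3) *
  (lift ord0 (lift ord0 ord0) = 2 :> 'I_3) * (ord0 = 0 :> 'I_3).
Proof. by do !split; exact: val_inj. Qed.

Lemma ord3_add : (1 + 1 = 2 :> 'I_3) * (1 + 2 = 0 :> 'I_3) *
  (2 + 1 = 0 :> 'I_3) * (2 + 2 = 1 :> 'I_3).
Proof. by do !split; exact: val_inj. Qed.

Lemma ord3_neq : ((0 == 1 :> 'I_3) = false) * ((0 == 2 :> 'I_3) = false) *
  ((1 == 0 :> 'I_3) = false) * ((1 == 2 :> 'I_3) = false) *
  ((2 == 0 :> 'I_3) = false) * ((2 == 1 :> 'I_3) = false).
Proof. by []. Qed.

Section Calculus.
Context {R : realType}.
Implicit Types (x : 'rV[R]_3) (f g : 'rV[R]_3 -> R) (i : 'I_3).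

Definition diffble f := forall x, differentiable f x.

Lemma partialD i f g : diffble f -> diffble g ->
  partial i (fun x => f x + g x) = fun x => partial i f x + partial i g x.
Proof.
move=> df dg; apply/funext => x; rewrite /partial.
by rewrite (@deriveD _ _ _ f g)//; exact: diff_derivable.
Qed.

Lemma partialM i f g : diffble f -> diffble g ->
  partial i (fun x => f x * g x) =
  fun x => f x * partial i g x + g x * partial i f x.
Proof.
move=> df dg; apply/funext => x; rewrite /partial.
by rewrite (@deriveM _ _ f g)//; exact: diff_derivable.
Qed.

Lemma partial_cst i (c : R) : partial i (fun=> c) = fun=> 0.
Proof. by apply/funext => x; rewrite /partial derive_cst. Qed.

Lemma partial_coord i (j : 'I_3) :
  partial i (fun x => x 0 j) = fun=> (i == j)%:R.
Proof.
apply/funext => x; rewrite /partial.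
have H : linear (fun x : 'rV[R]_3 => x 0 j) by move=> a u v; rewrite !mxE.
pose L : {linear 'rV[R]_3 -> R} := HB.pack (fun x : 'rV[R]_3 => x 0 j)
  (GRing.isLinear.Build _ _ _ _ _ H).
have cL : continuous L by apply: coord_continuous.
rewrite -[fun _ => _]/(L : _ -> _) deriveE; last exact: linear_differentiable.
by rewrite diff_lin //= mxE eqxx eq_sym.
Qed.

Lemma diffble_coord (j : 'I_3) : diffble (fun x => x 0 j).
Proof. by move=> x; apply: differentiable_coord. Qed.

(** Closing a set of functions under the ring operations makes it stable under
partial derivatives as soon as the generators have derivatives in the closure;
this reduces smoothness, which speaks of all iterated derivatives, to one
derivative of the generators. *)
Inductive alg (G : set ('rV[R]_3 -> R)) : ('rV[R]_3 -> R) -> Prop :=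
| alg_gen f : G f -> alg G f
| alg_cst c : alg G (fun=> c)
| alg_add f g : alg G f -> alg G g -> alg G (fun x => f x + g x)
| alg_mul f g : alg G f -> alg G g -> alg G (fun x => f x * g x).

(** By the product rule every derivative stays in the algebra, whose members are
differentiable, so differentiation can go on forever. *)
Lemma alg_smooth (G : set ('rV[R]_3 -> R)) :
  (forall f, G f -> diffble f /\ forall i, alg G (partial i f)) ->
  forall f, alg G f -> smooth f.
Proof.
move=> GP.
have step f : alg G f -> diffble f /\ forall i, alg G (partial i f).
  elim=> {f} [f /GP//|c|f g aGf [df pf] aGg [dg pg]|f g aGf [df pf] aGg [dg pg]].
  - split=> [x|i]; first exact: differentiable_cst.
    by rewrite partial_cst; apply: alg_cst.
  - split=> [x|i]; first exact: differentiableD.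
    by rewrite partialD//; apply: alg_add.
  - split=> [x|i]; first exact: differentiableM.
    by rewrite partialM//; apply: alg_add; apply: alg_mul.
move=> f aGf l.
suff : alg G (foldr partial f l) by move=> /step[].
by elim: l => //= i l /step[].
Qed.

Lemma smooth_diff f : smooth f -> diffble f.
Proof. by move=> /(_ [::]). Qed.

Lemma smooth_partial f i : smooth f -> smooth (partial i f).
Proof. by move=> sf l x; have := sf (rcons l i) x; rewrite foldr_rcons. Qed.

Lemma smooth_alg f : alg smooth f -> smooth f.
Proof.
apply: alg_smooth => {}f sf; split; first exact: smooth_diff.
by move=> i; apply: alg_gen; apply: smooth_partial.
Qed.

Lemma smooth_cst (c : R) : smooth (fun=> c : R).
Proof. by apply: smooth_alg; apply: alg_cst. Qed.

Lemma smoothD f g : smooth f -> smooth g -> smooth (fun x => f x + g x).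
Proof. by move=> sf sg; apply: smooth_alg; apply: alg_add; apply: alg_gen. Qed.

Lemma smoothM f g : smooth f -> smooth g -> smooth (fun x => f x * g x).
Proof. by move=> sf sg; apply: smooth_alg; apply: alg_mul; apply: alg_gen. Qed.

Lemma smooth_coord i : smooth (fun x => x 0 i).
Proof.
apply: (@alg_smooth (range (fun i x => x 0 i))); last first.
  by apply: alg_gen; exists i.
move=> _ [j _ <-]; split; first exact: diffble_coord.
by move=> k; rewrite partial_coord; apply: alg_cst.
Qed.

Lemma smoothN f : smooth f -> smooth (fun x => - f x).
Proof.
move=> sf; have -> : (fun x => - f x) = (fun x => (-1) * f x).
  by apply/funext => x; rewrite mulN1r.
by apply: smoothM => //; apply: smooth_cst.
Qed.

Lemma smoothB f g : smooth f -> smooth g -> smooth (fun x => f x - g x).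
Proof. by move=> sf sg; apply: smoothD => //; apply: smoothN. Qed.

Lemma smooth_sum (I : Type) (r : seq I) (P : pred I) (F : I -> 'rV[R]_3 -> R) :
  (forall k, P k -> smooth (F k)) -> smooth (fun x => \sum_(k <- r | P k) F k x).
Proof.
move=> sF; elim: r => [|k r IH].
  by under eq_fun do rewrite big_nil; exact: smooth_cst.
under eq_fun do rewrite big_cons; case Pk : (P k) => //.
by apply: smoothD => //; apply: sF.
Qed.

Lemma smooth_prod (I : Type) (r : seq I) (P : pred I) (F : I -> 'rV[R]_3 -> R) :
  (forall k, P k -> smooth (F k)) -> smooth (fun x => \prod_(k <- r | P k) F k x).
Proof.
move=> sF; elim: r => [|k r IH].
  by under eq_fun do rewrite big_nil; exact: smooth_cst.
under eq_fun do rewrite big_cons; case Pk : (P k) => //.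
by apply: smoothM => //; apply: sF.
Qed.

Lemma partialN i f : diffble f ->
  partial i (fun x => - f x) = fun x => - partial i f x.
Proof.
move=> df; apply/funext => x; rewrite /partial.
by rewrite (@deriveN _ _ _ f)//; exact: diff_derivable.
Qed.

Lemma partialB i f g : diffble f -> diffble g ->
  partial i (fun x => f x - g x) = fun x => partial i f x - partial i g x.
Proof.
move=> df dg; rewrite partialD ?partialN// => x.
exact: differentiableN.
Qed.

Lemma partialZ i (c : R) f : diffble f ->
  partial i (fun x => c * f x) = fun x => c * partial i f x.
Proof.
move=> df; rewrite (partialM _ (fun x => differentiable_cst c x) df).
by rewrite partial_cst; apply/funext => x; rewrite mulr0 addr0.
Qed.

Lemma smoothX f n : smooth f -> smooth (fun x => f x ^+ n).
Proof.
move=> sf; elim: n => [|n IH]; first by under eq_fun do rewrite expr0; exact: smooth_cst.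
by under eq_fun do rewrite exprS; apply: smoothM.
Qed.

Definition monom (a : 'I_3 -> nat) x : R := \prod_(i < 3) x 0 i ^+ a i.

Lemma smooth_monom a : smooth (monom a).
Proof. by apply: smooth_prod => i _; apply: smoothX; apply: smooth_coord. Qed.

Lemma polyfun_monom s a : (\sum_(i < 3) a i <= s)%N -> polyfun s (monom a).
Proof.
move=> le; exists (mpoly.mpolyX R (mpoly.Multinom [tuple a i | i < 3])).
  rewrite mpoly.msizeX ltnS mpoly.mdegE.
  by under eq_bigr do rewrite mpoly.mnmE.
move=> x; rewrite mpoly.mevalX; apply: eq_bigr => i _.
by rewrite mpoly.mnmE.
Qed.

Lemma polyfunD s f g : polyfun s f -> polyfun s g -> polyfun s (fun x => f x + g x).
Proof.
move=> [p ps pE] [q qs qE]; exists (p + q); last by move=> x; rewrite pE qE mpoly.mevalD.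
by rewrite (leq_trans (mpoly.mmeasureD_le _ _ _))// geq_max ps qs.
Qed.

Lemma polyfunZ s (c : R) f : polyfun s f -> polyfun s (fun x => c * f x).
Proof.
move=> [p ps pE]; exists (c *: p); last by move=> x; rewrite pE mpoly.mevalZ.
by rewrite (leq_trans (mpoly.msizeZ_le _ _)).
Qed.

Lemma polyfun0 s : polyfun s (fun=> 0 : R).
Proof. by exists 0; [rewrite mpoly.msize0 | move=> x; rewrite mpoly.meval0]. Qed.

(** Properties of polynomials are proved on the monomials of bounded degree and
extended by linearity. Smoothness is carried along since the rules for the
derivatives of sums and multiples need it. *)
Lemma polyfun_ind s (P : ('rV[R]_3 -> R) -> Prop) :
  P (fun=> 0) ->
  (forall a, (\sum_(i < 3) a i <= s)%N -> P (monom a)) ->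
  (forall c f, smooth f -> P f -> P (fun x => c * f x)) ->
  (forall f g, smooth f -> smooth g -> P f -> P g -> P (fun x => f x + g x)) ->
  forall f, polyfun s f -> P f.
Proof.
move=> P0 PX PZ PD f [p ps pE].
have -> : f = fun x => \sum_(m <- mpoly.msupp p)
    mpoly.mcoeff m p * monom (fun i => m i) x.
  by apply/funext => x; rewrite pE mpoly.mevalE.
have : forall m, m \in mpoly.msupp p -> (\sum_(i < 3) m i <= s)%N.
  move=> m /mpoly.msize_mdeg_lt; rewrite mpoly.mdegE => h.
  by rewrite -ltnS (leq_trans h).
elim: (mpoly.msupp p : seq _) => [|m r IH] H.
  by under eq_fun do rewrite big_nil; exact: P0.
under eq_fun do rewrite big_cons.
apply: PD.
- by apply: smoothM; [apply: smooth_cst|apply: smooth_monom].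
- apply: smooth_sum => k _.
  by apply: smoothM; [apply: smooth_cst|apply: smooth_monom].
- apply: PZ; first exact: smooth_monom.
  by apply: PX; apply: H; rewrite mem_head.
- by apply: IH => k kr; apply: H; rewrite inE kr orbT.
Qed.

Lemma polyfun_smooth s f : polyfun s f -> smooth f.
Proof.
elim/polyfun_ind => [|a _|c g _|g h _ _].
- exact: smooth_cst.
- exact: smooth_monom.
- by apply: smoothM; apply: smooth_cst.
- exact: smoothD.
Qed.

Lemma partialX i f n : smooth f ->
  partial i (fun x => f x ^+ n) = fun x => n%:R * (f x ^+ n.-1 * partial i f x).
Proof.
move=> sf; apply/funext => x; rewrite /partial.
rewrite (_ : (fun x => _) = f ^+ n); last by apply/funext => y; rewrite fctE.
rewrite deriveX; last exact: diff_derivable (smooth_diff sf x).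
by rewrite -[LHS]mulrA.
Qed.

Lemma partial_monom i a : partial i (monom a) =
  fun x => (a i)%:R * monom (fun j => a j - (i == j))%N x.
Proof.
have -> : monom a = fun x => x 0 i ^+ a i * \prod_(j < 3 | j != i) x 0 j ^+ a j.
  by apply/funext => x; rewrite /monom (bigD1 i).
rewrite partialM; first last.
- by apply: smooth_diff; apply: smooth_prod => j _; apply/smoothX/smooth_coord.
- by apply: smooth_diff; apply/smoothX/smooth_coord.
rewrite partialX; last exact: smooth_coord.
have -> : partial i (fun x => \prod_(j < 3 | j != i) x 0 j ^+ a j) = fun=> 0.
  elim: (index_enum _) => [|j r IH].
    by under [X in partial _ X]eq_fun do rewrite big_nil; rewrite partial_cst.
  under [X in partial _ X]eq_fun do rewrite big_cons; case ji : (j != i) => //.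
  rewrite partialM; first last.
  - by apply: smooth_diff; apply: smooth_prod => k _; apply/smoothX/smooth_coord.
  - by apply: smooth_diff; apply/smoothX/smooth_coord.
  rewrite IH partialX; last exact: smooth_coord.
  by apply/funext => x; rewrite partial_coord eq_sym (negbTE ji) !mulr0 addr0.
apply/funext => x; rewrite partial_coord eqxx /monom [in RHS](bigD1 i)//= eqxx subn1.
rewrite mulr0 add0r mulr1 mulrC -mulrA; congr (_ * (_ * _)).
by apply: eq_bigr => j ji; rewrite eq_sym (negbTE ji) subn0.
Qed.

Lemma sum_lower_exponent (a : 'I_3 -> nat) i : (0 < a i)%N ->
  (\sum_(j < 3) (a j - (i == j)) + 1 = \sum_(j < 3) a j)%N.
Proof.
move=> ai; rewrite (bigD1 i)//= eqxx [in RHS](bigD1 i)//= subn1 addnAC addn1 prednK//.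
by congr addn; apply: eq_bigr => j ji; rewrite eq_sym (negbTE ji) subn0.
Qed.

Lemma polyfun_partial s i f : polyfun s f -> polyfun s (partial i f).
Proof.
elim/polyfun_ind => [|a H|c g sg|g h sg sh].
- by rewrite partial_cst; apply: polyfun0.
- rewrite partial_monom; apply: polyfunZ; apply: polyfun_monom.
  by apply: leq_trans H; apply: leq_sum => j _; exact: leq_subr.
- by rewrite partialZ; [apply: polyfunZ|exact: smooth_diff].
- by rewrite partialD; [apply: polyfunD|exact: smooth_diff..].
Qed.

(** Differentiation lowers the degree by one before [x 0 j] raises it again; this
is why [x . grad q] has the degree of [q]. *)
Lemma polyfun_mul_partial s (i j : 'I_3) f : polyfun s f ->
  polyfun s (fun x => x 0 j * partial i f x).
Proof.
elim/polyfun_ind => [|a H|c g sg IH|g h sg sh IHg IHh].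
- by rewrite partial_cst; under eq_fun do rewrite /= mulr0; apply: polyfun0.
- case: (posnP (a i)) => [ai0|ai0].
    rewrite partial_monom ai0; under eq_fun do rewrite mul0r mulr0.
    exact: polyfun0.
  have -> : (fun x => x 0 j * partial i (monom a) x) =
     fun x => (a i)%:R * monom (fun k => (a k - (i == k)) + (j == k))%N x.
    apply/funext => x; rewrite partial_monom mulrCA; congr (_ * _).
    rewrite /monom; under [RHS]eq_bigr do rewrite exprD.
    rewrite big_split /= mulrC; congr (_ * _).
    by rewrite (bigD1 j)//= eqxx expr1 big1 ?mulr1// => k /negbTE; rewrite eq_sym => ->.
  apply: polyfunZ; apply: polyfun_monom; rewrite big_split/=.
  rewrite [X in (_ + X)%N](_ : _ = 1%N) ?sum_lower_exponent//.
  by rewrite (bigD1 j)//= eqxx big1 ?addn0// => k /negbTE; rewrite eq_sym => ->.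
- rewrite partialZ; last exact: smooth_diff.
  by under eq_fun do rewrite /= mulrCA; apply: polyfunZ.
- rewrite partialD; [|exact: smooth_diff..].
  by under eq_fun do rewrite /= mulrDr; apply: polyfunD.
Qed.

End Calculus.

(** * Symmetry of second derivatives and a flat step function *)

Section Schwarz.
Context {R : realType}.
Implicit Types (x : 'rV[R]_3) (f g : 'rV[R]_3 -> R) (i : 'I_3).

Let e i : 'rV[R]_3 := delta_mx 0 i.

Lemma line_is_derive f i x (s : R) : diffble f ->
  is_derive s (1 : R) (fun s => f (x + s *: e i)) (partial i f (x + s *: e i)).
Proof.
move=> df.
have E : (fun h : R => h^-1 *: (((fun s => f (x + s *: e i)) \o shift s) (h *: 1)
            - f (x + s *: e i))) =
         (fun h : R => h^-1 *: ((f \o shift (x + s *: e i)) (h *: e i)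
            - f (x + s *: e i))).
  apply/funext => h /=; congr (_ *: (f _ - _)).
  by rewrite [h%:A]mulr1 scalerDl addrCA addrA.
apply: DeriveDef; last by rewrite /derive E.
by rewrite /derivable E; apply: (diff_derivable (df _)).
Qed.

Lemma line_continuous f i x : diffble f -> continuous (fun s : R => f (x + s *: e i)).
Proof.
move=> df s; apply: differentiable_continuous; apply/derivable1_diffP.
exact: (@ex_derive _ _ _ _ _ _ _ (line_is_derive i x s df)).
Qed.

(** The mean value theorem, first along [e i] and then along [e j]. *)
Lemma mixed_difference f i j x (h : R) : smooth f -> 0 < h ->
  exists a b, [/\ 0 <= a <= h, 0 <= b <= h &
    f (x + h *: e i + h *: e j) - f (x + h *: e i) - f (x + h *: e j) + f x =
    h ^+ 2 * partial j (partial i f) (x + a *: e i + b *: e j)].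
Proof.
move=> sf h0; have df := smooth_diff sf.
have dpf := smooth_diff (smooth_partial i sf).
pose F := fun s : R => f ((x + h *: e j) + s *: e i) - f (x + s *: e i).
pose dF := fun s : R => partial i f ((x + h *: e j) + s *: e i) - partial i f (x + s *: e i).
have dFP (s : R) : is_derive s (1 : R) F (dF s).
  by apply: is_deriveB; apply: line_is_derive.
have cF : {within `[0, h], continuous F}.
  apply: continuous_subspaceT => s.
  by apply: continuousB; apply: line_continuous.
have [a + Fa] := MVT h0 (fun s _ => dFP s) cF.
rewrite in_itv /= => /andP[a0 ah].
pose y := x + a *: e i.
have cG : {within `[0, h], continuous (fun s : R => partial i f (y + s *: e j))}.
  by apply: continuous_subspaceT; apply: line_continuous.
have [b + Gb] := MVT h0 (fun s _ => line_is_derive j y s dpf) cG.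
rewrite in_itv /= => /andP[b0 bh].
exists a, b; split; [by rewrite !ltW|by rewrite !ltW|].
move: Fa Gb; rewrite /F /dF !scale0r !addr0 subr0 => Fa Gb.
rewrite -[x + h *: e j + a *: e i]addrAC -/y in Fa.
rewrite [X in _ = X * h]Gb in Fa.
rewrite /y -[x + h *: e j + h *: e i]addrAC in Fa.
transitivity (partial j (partial i f) (x + a *: e i + b *: e j) * h * h); last by ring.
by rewrite -Fa; ring.
Qed.

(** Swapping [i] and [j] leaves the second difference of [mixed_difference]
unchanged, so both mixed derivatives are limits of the same quotient. *)
Lemma partial_comm f i j : smooth f ->
  partial i (partial j f) = partial j (partial i f).
Proof.
move=> sf; apply/funext => x; apply/eqP.
rewrite -subr_eq0 -normr_le0; apply/ler_addgt0Pl => /= eps eps0; rewrite addr0.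
have cont k l : {for x, continuous (partial k (partial l f))}.
  apply: differentiable_continuous; apply: smooth_diff.
  by do 2 apply: smooth_partial.
have e20 : 0 < eps / 2 by rewrite divr_gt0.
have /cvgrPdist_lt /(_ _ e20) /nbhs_ballP [d1 /= d10 H1] := cont i j.
have /cvgrPdist_lt /(_ _ e20) /nbhs_ballP [d2 /= d20 H2] := cont j i.
pose d := Num.min d1 d2; have d0 : 0 < d by rewrite lt_min d10.
(* Both intermediate points are then at distance at most [2 h < d] from [x]. *)
pose h := d / 4; have h0 : 0 < h by rewrite divr_gt0.
have near_x k l a b : 0 <= a <= h -> 0 <= b <= h -> `|x - (x + a *: e k + b *: e l)| < d.
  move=> /andP[a0 ah] /andP[b0 bh].
  rewrite -addrA opprD addrA subrr sub0r normrN.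
  rewrite (le_lt_trans (ler_normD _ _))// !normrZ !ger0_norm//.
  have n1 m : `|e m| <= 1.
    rewrite [`|_|]mx_normrE; apply: bigmax_le => // -[p q] _ /=.
    by rewrite mxE ger0_norm//; case: (_ && _).
  rewrite (@le_lt_trans _ _ (h + h))// ?lerD//.
  - by rewrite (le_trans _ ah)// ler_piMr.
  - by rewrite (le_trans _ bh)// ler_piMr.
  - by rewrite /h; lra.
have [a [b [ah bh E1]]] := mixed_difference i j x sf h0.
have [a' [b' [ah' bh' E2]]] := mixed_difference j i x sf h0.
have E : partial j (partial i f) (x + a *: e i + b *: e j) =
         partial i (partial j f) (x + a' *: e j + b' *: e i).
  have h20 : h ^+ 2 != 0 by rewrite expf_neq0// gt_eqF.
  rewrite [x + h *: e j + h *: e i]addrAC in E2.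
  move: E1 E2; rewrite [in f _ - f _ - _]addrAC => -> E2.
  exact: (mulfI h20).
have dd1 : d <= d1 by rewrite ge_min lexx.
have dd2 : d <= d2 by rewrite ge_min lexx orbT.
have N1 := H1 (x + a' *: e j + b' *: e i).
have {}N1 := N1 ltac:(rewrite -ball_normE; exact: lt_le_trans (near_x j i a' b' ah' bh') dd1).
have N2 := H2 (x + a *: e i + b *: e j).
have {}N2 := N2 ltac:(rewrite -ball_normE; exact: lt_le_trans (near_x i j a b ah bh) dd2).
rewrite /= in N1 N2; rewrite E in N2.
set P := partial i (partial j f) x in N1 *.
set Q := partial j (partial i f) x in N2 *.
set Z := partial i _ _ in N1 N2.
clearbody P Q Z; clear -N1 N2.
have -> : P - Q = (P - Z) - (Q - Z) by ring.
by rewrite (le_trans (ler_normB _ _))// [leRHS](splitr eps) lerD// ltW.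
Qed.

End Schwarz.

Section FlatStep.
Context {R : realType}.
Implicit Types t : R.

(** The functions [t^-k exp (-1/t)], extended by zero to [t <= 0]. Their span is
stable under differentiation, so [flat 0], which tends to 1 at infinity, is a
smooth function that vanishes for [t <= 0]: the raw material of the cut-off
functions. *)
Definition flat (k : nat) t : R := if 0 < t then t^-1 ^+ k * expR (- t^-1) else 0.

Lemma flat_ge0 k t : 0 <= flat k t.
Proof.
rewrite /flat; case: ifP => // t0.
by rewrite mulr_ge0 ?expR_ge0// exprn_ge0// invr_ge0 ltW.
Qed.

Lemma flat0_le1 t : flat 0 t <= 1.
Proof.
by rewrite /flat; case: ifP => // t0; rewrite expr0 mul1r expR_le1 oppr_le0 invr_ge0 ltW.
Qed.

(** The exponential dominates its Taylor monomials, hence [flat k] is flat to any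
order at 0. *)
Lemma flat_le k n t : 0 < t -> flat k t <= (n.+1 + k)`!%:R * t ^+ n.+1.
Proof.
move=> t0; rewrite /flat t0 expRN addSn.
have := expR_ge1Dxn (n + k) (ltW (etrans (invr_gt0 t) t0)).
set E := expR _; set F := (_`!%:R : R) => EF.
have F0 : 0 < F by rewrite ltr0n fact_gt0.
have E0 : 0 < E by exact: expR_gt0.
have : t^-1 ^+ (n + k).+1 <= E * F.
  by rewrite -ler_pdivrMr//; apply: le_trans EF; rewrite lerDr ler01.
rewrite -addSn exprD [t^-1 ^+ n.+1]exprVn.
have tn : 0 < t ^+ n.+1 by rewrite exprn_gt0.
by rewrite ler_pdivrMl// ler_pdivrMr// [E * F]mulrC mulrCA mulrA.
Qed.

Lemma flat_is_derive0 k : is_derive (0 : R) (1 : R) (flat k) 0.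
Proof.
have H : (fun h : R => h^-1 *: ((flat k \o shift 0) (h *: 1) - flat k 0)) @ 0^' --> (0 : R).
  (* Near 0, [flat k] is at most [C h^2]. *)
  set C : R := (2 + k)`!%:R.
  have C0 : 0 <= C by exact: ler0n.
  apply/cvgrPdist_le => eps eps0.
  have Ce : 0 < eps / (C + 1) by rewrite divr_gt0// ltr_wpDl.
  near=> h.
  rewrite /= sub0r normrN addr0 [h%:A]mulr1 [flat k 0]/flat ltxx subr0.
  have [h0|h0] := ltP 0 h; last first.
    by rewrite /flat ltNge h0 /= scaler0 normr0 ltW.
  rewrite normrM gtr0_norm ?invr_gt0// ger0_norm ?flat_ge0// mulrC ler_pdivrMr//.
  rewrite (le_trans (flat_le k 1 h0))// expr2 mulrA ler_pM2r//.
  have : `|0 - h| < eps / (C + 1).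
    by near: h; apply: nbhs_dnbhs; apply: nbhsx_ballx.
  rewrite sub0r normrN gtr0_norm// ltr_pdivlMr ?ltr_wpDl// => hC.
  by apply: ltW; apply: le_lt_trans hC; rewrite mulrDr mulr1 [C * h]mulrC lerDl ltW.
apply: DeriveDef; first by apply/cvg_ex; exists 0.
exact: (cvg_lim _ H).
Unshelve. all: by end_near. Qed.

Lemma flat_is_derive k t :
  is_derive t (1 : R) (flat k) (- k%:R * flat k.+1 t + flat k.+2 t).
Proof.
have [t0|t0|<-] := ltgtP 0 t.
- pose g t : R := t^-1 ^+ k * expR (- t^-1).
  have gE : \near t, g t = flat k t.
    by near=> r; rewrite /g /flat; case: ifPn => // /negP[]; near: r; apply: lt_nbhsr.
  apply: (near_eq_is_derive gE).
  have dV : is_derive t (1 : R) (fun t : R => t^-1) (- t ^- 2).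
    have H := @is_deriveV _ id t 1 1 (lt0r_neq0 t0) (is_derive_id _ _).
    by apply: is_derive_eq H _; rewrite [LHS]mulr1.
  have -> : g = (fun t : R => t^-1) ^+ k * (expR \o (fun t : R => - t^-1)).
    by apply/funext => y; rewrite /g !fctE.
  have dE : is_derive t (1 : R) (expR \o (fun t : R => - t^-1)) (expR (- t^-1) * t ^- 2).
    apply: is_derive1_comp.
    rewrite -[t ^- 2]opprK.
    exact: is_deriveN.
  apply: is_derive_eq; rewrite /flat t0 !fctE /= -exprVn.
  rewrite /GRing.scale /=; clear; set E := expR _; set a := t^-1; clearbody E a.
  by case: k => [|n]; rewrite ?succnK !exprS; ring.
- have gE : \near t, cst 0 t = flat k t.
    near=> r; rewrite /flat; case: ifPn => //; rewrite ltNge => /negP[].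
    by near: r; apply: lt_le_nbhsl.
  apply: (near_eq_is_derive gE).
  by rewrite /flat ltNge (ltW t0) /= mulr0 addr0; apply: is_derive_cst.
- by rewrite /flat ltxx mulr0 addr0; apply: flat_is_derive0.
Unshelve. all: by end_near. Qed.

Lemma flat0_cvgy : flat 0 t @[t --> +oo] --> (1 : R).
Proof.
apply/cvgrPdist_lt => eps eps0; near=> t.
have t0 : 0 < t by near: t; apply: nbhs_pinfty_gt; rewrite num_real.
have te : eps^-1 < t by near: t; apply: nbhs_pinfty_gt; rewrite num_real.
rewrite ger0_norm ?subr_ge0 ?flat0_le1// /flat t0 expr0 mul1r.
have := expR_ge1Dx (- t^-1); have : t^-1 < eps by rewrite invf_plt.
lra.
Unshelve. all: by end_near. Qed.

End FlatStep.

(** * Measurability and Fubini on R^3 *)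

Section BoundedSupport.
Context d (T : measurableType d) (R : realType) (mu : {measure set T -> \bar R}).

Lemma bounded_support_integrable (A : set T) (f : T -> R) (K : R) :
  measurable A -> (mu A < +oo)%E -> measurable_fun setT f ->
  (forall x, `|f x| <= K) -> (forall x, ~ A x -> f x = 0) ->
  mu.-integrable setT (EFin \o f).
Proof.
move=> mA fA mf fK f0.
have -> : f = f \_ A.
  apply/funext => x; rewrite patchE; case: ifPn => // xA.
  by rewrite f0// => Ax; rewrite mem_set in xA.
rewrite -restrict_EFin; apply/integrable_restrict => //; rewrite setTI.
apply: measurable_bounded_integrable => //.
  exact: measurable_funTS.
exists K; split; first exact: num_real.
by move=> M KM x _; rewrite /= (le_trans (fK x))// ltW.
Qed.

End BoundedSupport.

Section Space.
Context {R : realType}.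
Local Notation T3 := (measurableTypeR R * measurableTypeR R * measurableTypeR R)%type.
Implicit Types (c : T3) (A : set 'rV[R]_3).

Lemma vec3_0 c : vec3 c 0 0 = c.1.1. Proof. by rewrite mxE. Qed.
Lemma vec3_1 c : vec3 c 0 1 = c.1.2. Proof. by rewrite mxE. Qed.
Lemma vec3_2 c : vec3 c 0 2 = c.2. Proof. by rewrite mxE. Qed.

Definition rowbox (p q : 'I_3 -> R) : set T3 :=
  (`]p 0, q 0[%classic `*` `]p 1, q 1[%classic) `*` `]p 2, q 2[%classic.

(** An open set is the union of the rational boxes it contains, and there are
countably many of them. *)
Lemma open_vec3_measurable A : open A -> measurable (vec3 @^-1` A : set T3).
Proof.
move=> oA.
pose F (pq : {ffun 'I_3 -> rat} * {ffun 'I_3 -> rat}) : set T3 :=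
  let B := rowbox (fun i => ratr (pq.1 i)) (fun i => ratr (pq.2 i)) in
  if pselect (B `<=` vec3 @^-1` A) then B else set0.
have -> : vec3 @^-1` A = \bigcup_pq F pq.
  apply/seteqP; split => [c Ac|c [pq _]]; last first.
    by rewrite /F; case: pselect => // h /h.
  have /nbhs_ballP[eps /= eps0 H] : nbhs (vec3 c) A by exact: open_nbhs_nbhs.
  have /choice[p pP] (i : 'I_3) : exists p, ratr p \in `]vec3 c 0 i - eps, vec3 c 0 i[%R.
    by apply: rat_in_itvoo; rewrite ltrBlDr ltrDl.
  have /choice[q qP] (i : 'I_3) : exists q, ratr q \in `]vec3 c 0 i, vec3 c 0 i + eps[%R.
    by apply: rat_in_itvoo; rewrite ltrDl.
  exists ([ffun i => p i], [ffun i => q i]) => //; rewrite /F /=.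
  have E : rowbox (fun i => ratr ([ffun i => p i] i)) (fun i => ratr ([ffun i => q i] i))
      = rowbox (fun i => ratr (p i)) (fun i => ratr (q i)).
    by congr rowbox; apply/funext => i; rewrite ffunE.
  rewrite E; case: pselect => [h|[]] /=.
    move: (pP 0) (pP 1) (pP 2) (qP 0) (qP 1) (qP 2).
    rewrite !in_itv /= vec3_0 vec3_1 vec3_2.
    move=> /andP[_ p0] /andP[_ p1] /andP[_ p2] /andP[q0 _] /andP[q1 _] /andP[q2 _].
    by do !split; rewrite /= in_itv /=; apply/andP; split.
  move=> c' [[/=]]; rewrite !in_itv /= => /andP[a1 a2] /andP[b1 b2] /andP[d1 d2].
  apply: H; move: (pP 0) (pP 1) (pP 2) (qP 0) (qP 1) (qP 2).
  rewrite !in_itv /= vec3_0 vec3_1 vec3_2 => /andP[p0 _] /andP[p1 _] /andP[p2 _]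
    /andP[_ q0] /andP[_ q1] /andP[_ q2].
  rewrite -ball_normE /= [`|_|]mx_normrE; apply/bigmax_ltP; split => //= -[k i] _ /=.
  rewrite (ord1 k) {k} mxE [(- vec3 c') _ _]mxE.
  move: i; apply: ord3; rewrite ?vec3_0 ?vec3_1 ?vec3_2 ltr_norml;
    apply/andP; split; lra.
apply: countable_bigcupT_measurable => // pq.
rewrite /F; case: pselect => //= h.
by apply: measurableX; [apply: measurableX|]; exact: measurable_itv.
Qed.

Lemma continuous_vec3_measurable (f : 'rV[R]_3 -> R) :
  continuous f -> measurable_fun [set: T3] (f \o vec3).
Proof.
move=> /continuousP cf; apply: (measurability _ (measurable_realfun.RGenOpens.measurableE R)).
move=> _ [_ [a [b ->] <-]]; rewrite setTI.
exact: (open_vec3_measurable (cf _ (interval_open _ _))).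
Qed.

Lemma diffble_measurable (f : 'rV[R]_3 -> R) :
  diffble f -> measurable_fun [set: T3] (f \o vec3).
Proof.
by move=> df; apply: continuous_vec3_measurable => x; apply: differentiable_continuous.
Qed.

Definition cube (N : R) : set T3 := (`[-N, N] `*` `[-N, N]) `*` `[-N, N].

Lemma measurable_cube N : measurable (cube N).
Proof. by do 2?apply: measurableX; exact: measurable_itv. Qed.

Lemma cube_fin N : (leb3 (cube N) < +oo)%E.
Proof.
rewrite /leb3/= product_measure1E//; last exact: measurableX.
have itvfin : lebesgue_measure (`[-N, N] : set R) \is a fin_num.
  by rewrite /= lebesgue_measure_itv; case: ifP.
rewrite [X in (X * _)%E]product_measure1E//.
by rewrite -ge0_fin_numE ?fin_numM// mule_ge0// mule_ge0.
Qed.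

Lemma bounded_cube (A : set 'rV[R]_3) : bounded_set A ->
  exists2 N : R, 0 < N & forall c, A (vec3 c) -> cube N c.
Proof.
move=> [K [_ HK]]; exists (`|K| + 1); first by rewrite ltr_wpDl.
move=> c Ac.
have H i : `|vec3 c 0 i| <= `|K| + 1.
  have KK : K < `|K| + 1 by rewrite ltr_pwDr// ler_norm.
  rewrite (le_trans _ (HK _ KK _ Ac))// [leRHS]mx_normrE.
  exact: (@le_bigmax _ _ _ 0 (fun p => `|vec3 c p.1 p.2|) (0, i)).
move: (H 0) (H 1) (H 2); rewrite vec3_0 vec3_1 vec3_2 !ler_norml.
by move=> b0 b1 b2; do !split; rewrite /= in_itv.
Qed.

End Space.

Section IteratedZero.
Local Open Scope ereal_scope.
Context d1 d2 d3 (T1 : measurableType d1) (T2 : measurableType d2)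
  (T3 : measurableType d3) (R : realType).
Variables (m1 : {sigma_finite_measure set T1 -> \bar R})
  (m2 : {sigma_finite_measure set T2 -> \bar R})
  (m3 : {sigma_finite_measure set T3 -> \bar R}).
Variable f : T1 * T2 * T3 -> \bar R.
Hypothesis if3 : ((m1 \x m2) \x m3).-integrable setT f.
Hypothesis if2 : forall z, (m1 \x m2).-integrable setT (fun xy => f (xy, z)).

(* Iterating Fubini asks for a sigma-finite measure on the first two factors. *)
Let m12 : {sigma_finite_measure set (T1 * T2)%type -> \bar R} :=
  HB.pack (m1 \x m2)
    (lebesgue_integral_fubini.measure_function_Measure_isSigmaFinite__to__measure_function_isSigmaFinite m1 m2)
    (lebesgue_integral_fubini.measure_function_Measure_isSigmaFinite__to__measure_function_isSFinite m1 m2).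
Let iter3 := @integral12_prod_meas1 _ _ _ _ R m12 m3 f if3.
Let swap3 := @integral21_prod_meas1 _ _ _ _ R m12 m3 f if3.
Let iter2 z := integral12_prod_meas1 (if2 z).
Let swap2 z := integral21_prod_meas1 (if2 z).

(** Here and in the next two lemmas, Fubini puts the coordinate whose integrals are
known to vanish innermost. *)
Lemma integral_zero0 : (forall b z, \int[m1]_a f ((a, b), z) = 0) ->
  \int[(m1 \x m2) \x m3]_c f c = 0.
Proof.
move=> H; refine (etrans (esym swap3) _); apply: integral0_eq => z _.
by rewrite /fubini_G -swap2; apply: integral0_eq => b _; apply: H.
Qed.

Lemma integral_zero1 : (forall a z, \int[m2]_b f ((a, b), z) = 0) ->
  \int[(m1 \x m2) \x m3]_c f c = 0.
Proof.
move=> H; refine (etrans (esym swap3) _); apply: integral0_eq => z _.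
by rewrite /fubini_G -iter2; apply: integral0_eq => a _; apply: H.
Qed.

Lemma integral_zero2 : (forall a b, \int[m3]_z f ((a, b), z) = 0) ->
  \int[(m1 \x m2) \x m3]_c f c = 0.
Proof.
by move=> H; refine (etrans (esym iter3) _); apply: integral0_eq => -[a b] _; apply: H.
Qed.

End IteratedZero.

Section Lines.
Context {R : realType}.
Local Notation T3 := (measurableTypeR R * measurableTypeR R * measurableTypeR R)%type.
Local Notation mu := (@lebesgue_measure R).
Implicit Types (c : T3) (A : set 'rV[R]_3) (g : 'rV[R]_3 -> R).

Let e i : 'rV[R]_3 := delta_mx 0 i.

Lemma vec3_line0 a b z : vec3 (a, b, z) = vec3 (0, b, z) + a *: e 0 :> 'rV[R]_3.
Proof.
apply/rowP; apply: ord3; rewrite !mxE /= ?eqxx /=;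
by rewrite ?mulr1 ?mulr0 ?addr0 ?add0r.
Qed.

Lemma vec3_line1 a b z : vec3 (a, b, z) = vec3 (a, 0, z) + b *: e 1 :> 'rV[R]_3.
Proof.
apply/rowP; apply: ord3; rewrite !mxE /= ?eqxx /=;
by rewrite ?mulr1 ?mulr0 ?addr0 ?add0r.
Qed.

Lemma vec3_line2 a b z : vec3 (a, b, z) = vec3 (a, b, 0) + z *: e 2 :> 'rV[R]_3.
Proof.
apply/rowP; apply: ord3; rewrite !mxE /= ?eqxx /=;
by rewrite ?mulr1 ?mulr0 ?addr0 ?add0r.
Qed.

(** Fubini with the [i]-th coordinate innermost. This serves twice: for the
divergence theorem, where the line integrals vanish by the fundamental theorem of
calculus, and for null planes, which suitable lines meet in one point. *)
Lemma integral_lines0 (i : 'I_3) g (N K : R) :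
  measurable_fun [set: T3] (g \o vec3) -> (forall x, `|g x| <= K) ->
  (forall c, ~ cube N c -> g (vec3 c) = 0) ->
  (forall x, (\int[mu]_s (g (x + s *: e i))%:E = 0)%E) ->
  (\int[leb3]_c (g (vec3 c))%:E = 0)%E.
Proof.
move=> mg gK g0.
have ig : leb3.-integrable setT (EFin \o (g \o vec3)).
  apply: (bounded_support_integrable (measurable_cube N) (cube_fin N) mg _ g0).
  by move=> c /=.
have ixy z : (mu \x mu)%E.-integrable setT (EFin \o (fun xy => g (vec3 (xy, z)))).
  pose Q : set (measurableTypeR R * measurableTypeR R) := `[-N, N] `*` `[-N, N].
  have mQ : measurable Q by apply: measurableX; exact: measurable_itv.
  have Qfin : ((mu \x mu)%E Q < +oo)%E.
    rewrite [X in (X < _)%E]product_measure1E//.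
    have itvfin : mu (`[-N, N] : set R) \is a fin_num.
      by rewrite /= lebesgue_measure_itv; case: ifP.
    by rewrite -ge0_fin_numE ?fin_numM// mule_ge0.
  apply: (bounded_support_integrable mQ Qfin (K := K)) => //.
    by apply: (measurableT_comp mg); exact: pair2_measurable.
  by move=> xy xyQ; apply: g0 => -[].
move: i; apply: ord3 => line0.
- apply: (integral_zero0 ig ixy) => b z.
  refine (etrans _ (line0 (vec3 (0, b, z)))); apply: eq_integral => s _.
  by rewrite /= vec3_line0.
- apply: (integral_zero1 ig ixy) => a z.
  refine (etrans _ (line0 (vec3 (a, 0, z)))); apply: eq_integral => s _.
  by rewrite /= vec3_line1.
- refine (integral_zero2 ig _) => a b.
  refine (etrans _ (line0 (vec3 (a, b, 0)))); apply: eq_integral => s _.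
  by rewrite /= vec3_line2.
Qed.

Lemma integral_derive0 (h dh : R -> R) (N : R) : 0 < N ->
  (forall s : R, is_derive s (1 : R) h (dh s)) -> continuous dh ->
  (forall s, N <= `|s| -> h s = 0 /\ dh s = 0) ->
  (\int[mu]_s (dh s)%:E = 0)%E.
Proof.
move=> N0 hdh cdh supp.
have NN : - N < N by rewrite gtrN.
have -> : (fun s => (dh s)%:E) = (fun s => (dh s)%:E) \_ `[-N, N].
  apply/funext => s; rewrite patchE; case: ifPn => // /negP sN.
  rewrite (supp s _).2// leNgt ltr_norml.
  by apply/negP => /andP[a b]; apply: sN; rewrite inE /= in_itv /= !ltW.
rewrite -integral_mkcond.
have ch : continuous h.
  move=> s; apply: differentiable_continuous; apply/derivable1_diffP.
  exact: (@ex_derive _ _ _ _ _ _ _ (hdh s)).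
rewrite (@continuous_FTC2 _ dh h)//.
- rewrite (supp N _).1 ?(supp (-N) _).1 ?subee//.
    by rewrite normrN ler_norm.
  by rewrite ler_norm.
- by apply: continuous_subspaceT.
- split.
  + by move=> s _; exact: (@ex_derive _ _ _ _ _ _ _ (hdh s)).
  + by apply: cvg_at_right_filter; apply: ch.
  + by apply: cvg_at_left_filter; apply: ch.
- by move=> s _; rewrite derive1E; exact: derive_val.
Qed.

Lemma singleton_integral0 (h : R -> R) (s0 : R) :
  (forall s, s != s0 -> h s = 0) -> (\int[mu]_s (h s)%:E = 0)%E.
Proof.
move=> h0.
have -> : (fun s => (h s)%:E) = (fun s => (h s)%:E) \_ [set s0].
  apply/funext => s; rewrite patchE; case: ifPn => // ss.
  by rewrite h0//; apply: contraNneq ss => ->; rewrite inE.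
by rewrite -integral_mkcond integral_set1.
Qed.

Lemma partial_outside i f (C : set 'rV[R]_3) x : compact C ->
  (forall x, ~ C x -> f x = 0) -> ~ C x -> partial i f x = 0.
Proof.
move=> cC f0 nCx.
have clC : closed C by apply: compact_closed => //; exact: norm_hausdorff.
transitivity ('D_(delta_mx 0 i) (cst 0) x : R); last exact: derive_cst.
apply: near_eq_derive; near=> y; rewrite f0 //; near: y.
exact: (open_nbhs_nbhs (conj (closed_openC clC) nCx)).
Unshelve. all: by end_near. Qed.

(** The divergence theorem for one compactly supported component. *)
Lemma integral_partial0 (i : 'I_3) g (C : set 'rV[R]_3) : smooth g ->
  compact C -> (forall x, ~ C x -> g x = 0) ->
  (\int[leb3]_c (partial i g (vec3 c))%:E = 0)%E.
Proof.
move=> sg cC g0.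
have dg := smooth_diff sg; have dpg := smooth_diff (smooth_partial i sg).
have pg0 x : ~ C x -> partial i g x = 0 by exact: partial_outside.
have [N N0 NC] := bounded_cube (compact_bounded cC).
have cpg : continuous (partial i g) by move=> x; apply: differentiable_continuous.
have [K KP] : exists K, forall x, `|partial i g x| <= K.
  have [C0|/set0P C0] := eqVneq C set0.
    by exists 0 => x; rewrite pg0 ?normr0 ?C0.
  have cn : {within C, continuous (fun x => `|partial i g x|)}.
    apply: continuous_subspaceT => x.
    by apply: (continuous_comp (cpg x)); exact: norm_continuous.
  have [x0 _ xmax] := compact_EVT_max C0 cC cn.
  exists `|partial i g x0| => x; have [Cx|nCx] := pselect (C x).
    by apply: xmax; rewrite inE.
  by rewrite pg0// normr0.
apply: (integral_lines0 (i := i) (N := N) (K := K)) => //.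
- exact: diffble_measurable.
- by move=> c nc; apply: pg0 => /NC.
move=> x.
(* For [M <= |s|] the [i]-th coordinate of [x + s e_i] exceeds [N]. *)
pose M := N + `|x 0 i| + 1.
have M0 : 0 < M by rewrite /M; have := normr_ge0 (x 0 i); lra.
apply: (@integral_derive0 (fun s => g (x + s *: e i)) _ M) => //.
- by move=> s; apply: line_is_derive.
- by move=> s; apply: line_continuous.
move=> s Ms.
suff nC : ~ C (x + s *: e i) by rewrite g0// pg0.
have [c cE] : exists c : T3, vec3 c = x + s *: e i.
  exists ((x + s *: e i) 0 0, (x + s *: e i) 0 1, (x + s *: e i) 0 2).
  by apply/rowP; apply: ord3; rewrite [LHS]mxE.
rewrite -cE => /NC [[/= c0 c1] c2].
have ci : `|vec3 c 0 i| <= N.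
  move: c0 c1 c2; rewrite !in_itv /= -!ler_norml => c0 c1 c2.
  by clear -c0 c1 c2; move: i; apply: ord3; rewrite ?vec3_0 ?vec3_1 ?vec3_2.
move: ci; rewrite cE !mxE !eqxx mulr1 => ci.
have := ler_normB (x 0 i + s) (x 0 i).
rewrite addrAC subrr add0r; move: Ms ci; rewrite /M; lra.
Qed.

End Lines.

(** * Affine functions, null planes and smooth steps *)

Section Affine.
Context {R : realType}.
Implicit Types (x : 'rV[R]_3) (f : 'rV[R]_3 -> R).

Definition affine_with (al : 'rV[R]_3) f := exists b, forall x, f x = dot al x + b.

Lemma dotDr (a x y : 'rV[R]_3) : dot a (x + y) = dot a x + dot a y.
Proof. by rewrite /dot -big_split; apply: eq_bigr => i _; rewrite mxE mulrDr. Qed.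

Lemma dotZr (a x : 'rV[R]_3) (s : R) : dot a (s *: x) = s * dot a x.
Proof. by rewrite /dot mulr_sumr; apply: eq_bigr => i _; rewrite mxE mulrCA. Qed.

Lemma dot_delta (a : 'rV[R]_3) (i : 'I_3) : dot a (delta_mx 0 i) = a 0 i.
Proof.
rewrite /dot (bigD1 i)//= mxE !eqxx mulr1 big1 ?addr0// => j ji.
by rewrite mxE (negbTE ji) andbF mulr0.
Qed.

Lemma dotxx_gt0 (a : 'rV[R]_3) : a != 0 -> 0 < dot a a.
Proof.
move=> a0; rewrite lt0r; apply/andP; split; last first.
  by apply: sumr_ge0 => i _; rewrite -expr2 sqr_ge0.
apply: contra a0; rewrite /dot psumr_eq0 => [/allP H|i _]; last first.
  by rewrite -expr2 sqr_ge0.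
apply/eqP/rowP => i; rewrite mxE.
by have /H := mem_index_enum i; rewrite mulf_eq0 orbb => /eqP.
Qed.

Lemma affine_smooth al f : affine_with al f -> smooth f.
Proof.
move=> [b fE]; rewrite (_ : f = fun x => dot al x + b); last exact/funext.
apply: smoothD; last exact: smooth_cst.
apply: smooth_sum => i _; apply: smoothM; [exact: smooth_cst|exact: smooth_coord].
Qed.

Lemma affine_line al f x y s : affine_with al f -> f (x + s *: y) = f x + s * dot al y.
Proof. by move=> [b fE]; rewrite !fE dotDr dotZr addrAC. Qed.

Lemma smooth_continuous f : smooth f -> continuous f.
Proof. by move=> sf x; apply: differentiable_continuous; apply: smooth_diff. Qed.

(** Along a coordinate direction that is not parallel to the plane, every line
meets it at most once. *)
Lemma plane_null (A : set 'rV[R]_3) al f : open A -> bounded_set A -> al != 0 ->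
  affine_with al f ->
  leb3.-negligible (vec3 @^-1` (A `&` [set x | f x = 0])).
Proof.
move=> oA bA al0 aff.
have [N N0 NC] := bounded_cube bA.
pose g x : R := \1_(A `&` [set x | f x = 0]) x.
have mS : measurable (vec3 @^-1` (A `&` [set x | f x = 0]) :
    set (measurableTypeR R * measurableTypeR R * measurableTypeR R)).
  rewrite preimage_setI; apply: measurableI; first exact: open_vec3_measurable.
  have -> : [set x | f x = 0] = ~` [set x | f x != 0].
    by apply/seteqP; split => x /= => [->|/negP]; rewrite ?eqxx // negbK => /eqP.
  have oF : open [set x | f x != 0].
    apply: (@open_comp _ _ f [set y | y != 0]); last exact: open_neq.
    by move=> x _; apply: smooth_continuous; exact: affine_smooth aff.
  by rewrite preimage_setC; apply: measurableC; exact: (open_vec3_measurable oF).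
suff S0 : leb3 (vec3 @^-1` (A `&` [set x | f x = 0])) = 0%E by apply/(negligibleP _ mS).
have [i ali] : exists i, al 0 i != 0.
  apply: contrapT => H; move/negP: al0; apply; apply/eqP/rowP => i; rewrite mxE.
  by apply/eqP; apply: contrapT => /negP ali; apply: H; exists i.
have := integral_indic leb3 measurableT mS; rewrite setIT => <-.
refine (etrans _ (@integral_lines0 _ i g N 1 _ _ _ _)) => //.
- by have /(measurable_realfun.measurable_indicP) := mS; apply.
- by move=> x; rewrite /g indicE; case: (_ \in _); rewrite ?normr1 ?normr0.
- by move=> c nc; rewrite /g indicE memNset// => -[/NC].
move=> x; apply: (@singleton_integral0 _ _ (- f x / al 0 i)) => s sne.
rewrite /g indicE memNset// => -[_ /=].
rewrite (affine_line _ _ _ aff) => E; move/negP: sne; apply; apply/eqP.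
by move: E; rewrite dot_delta => /eqP; rewrite addrC addr_eq0 => /eqP <-; rewrite mulfK.
Qed.

Lemma flat_comp_partial k f i : smooth f ->
  partial i (fun x => flat k (f x)) =
  fun x => (- k%:R * flat k.+1 (f x) + flat k.+2 (f x)) * partial i f x.
Proof.
move=> sf; apply/funext => x; rewrite /partial.
have df := smooth_diff sf x.
have H := flat_is_derive k (f x).
have dk : differentiable (flat k) (f x).
  by apply/derivable1_diffP; exact: (@ex_derive _ _ _ _ _ _ _ H).
rewrite [LHS]deriveE; last exact: differentiable_comp.
rewrite diff_comp// (deriv1E (@ex_derive _ _ _ _ _ _ _ H)) /= derive1E derive_val.
by rewrite -deriveE// [LHS]mulrC.
Qed.

Lemma smooth_flat k f : smooth f -> smooth (fun x => flat k (f x)).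
Proof.
move=> sf.
apply: (@alg_smooth _ (smooth `|` range (fun k x => flat k (f x)))).
  move=> g [sg|[j _ <-]].
    split; first exact: smooth_diff.
    by move=> i; apply: alg_gen; left; apply: smooth_partial.
  split=> [x|i].
    apply: (differentiable_comp (smooth_diff sf x)); apply/derivable1_diffP.
    exact: (@ex_derive _ _ _ _ _ _ _ (flat_is_derive j (f x))).
  rewrite flat_comp_partial//; apply: alg_mul; last first.
    by apply: alg_gen; left; apply: smooth_partial.
  apply: alg_add; last by apply: alg_gen; right; exists j.+2.
  apply: (@alg_mul _ _ (fun=> - j%:R)); first exact: alg_cst.
  by apply: alg_gen; right; exists j.+1.
by apply: alg_gen; right; exists k.
Qed.

End Affine.

(** * Barycentric coordinates and cut-off functions of a cell *)

Section Barycentric.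
Context {R : realType} (M : mesh R).
Implicit Types (x : 'rV[R]_3) (K L : {set 'I_(nvtx M)}).

(** [lam i] is the barycentric coordinate of [K] at its vertex [i]; its gradient
[al i] is kept because a nonzero gradient makes the facets null sets. *)
Definition barycentric K (lam : 'I_(nvtx M) -> 'rV[R]_3 -> R)
    (al : 'I_(nvtx M) -> 'rV[R]_3) :=
  [/\ forall i, affine_with (al i) (lam i),
      forall x, \sum_(i in K) lam i x = 1,
      forall x, x = \sum_(i in K) lam i x *: vtx i &
      forall (w : 'I_(nvtx M) -> R) i, \sum_(j in K) w j = 1 -> i \in K ->
        lam i (\sum_(j in K) w j *: vtx j) = w i].

(** The rows [(1, v)], for the four vertices [v], form a square matrix that affine
independence makes invertible; the coordinates of [x] are [(1, x)] times its
inverse. *)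
Lemma barycentric_exists K : #|K| = 4%N -> affinely_free K ->
  exists lam al, barycentric K lam al.
Proof.
move=> K4 free.
pose f (k : 'I_4) : 'I_(nvtx M) := enum_val (cast_ord (esym K4) k).
have fK k : f k \in K by exact: enum_valP.
have [i0 i0K] : exists i0, i0 \in K.
  by apply/card_gt0P; rewrite K4.
pose g (i : 'I_(nvtx M)) : 'I_4 := cast_ord K4 (enum_rank_in i0K i).
have fgK i : i \in K -> f (g i) = i.
  by move=> iK; rewrite /f /g cast_ordK enum_rankK_in.
have gfK k : g (f k) = k.
  by rewrite /f /g enum_valK_in cast_ordKV.
have sumK (V : nmodType) (F : 'I_(nvtx M) -> V) :
    \sum_(i in K) F i = \sum_(k < 4) F (f k).
  rewrite (reindex_onto f g) /=; last by move=> i iK; exact: fgK.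
  by apply: eq_bigl => k; rewrite fK gfK eqxx.
pose V : 'M[R]_(4, 1 + 3) := row_mx (const_mx 1) (\matrix_(k < 4) vtx (f k)).
have wV (w : 'rV[R]_4) :
    w *m V = row_mx (\sum_k w 0 k)%:M (\sum_k w 0 k *: vtx (f k)).
  rewrite mul_mx_row; congr row_mx.
    apply/rowP => j; rewrite (ord1 j) !mxE eqxx mulr1n.
    by apply: eq_bigr => k _; rewrite mxE mulr1.
  by rewrite mulmx_sum_row; apply: eq_bigr => k _; rewrite rowK.
have Vunit : (V : 'M[R]_4) \in unitmx.
  rewrite -row_free_unit; apply: inj_row_free => w.
  move=> H0.
  have [/matrixP/(_ 0 0) s0 /esym v0] :
      (\sum_k w 0 k)%:M = 0 :> 'M[R]_1 /\ 0 = \sum_k w 0 k *: vtx (f k).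
    have H : row_mx (\sum_k w 0 k)%:M (\sum_k w 0 k *: vtx (f k)) =
        row_mx 0 0 :> 'rV[R]_(1 + 3).
      by rewrite -wV row_mx0.
    by have [-> ->] := eq_row_mx H.
  rewrite !mxE eqxx mulr1n in s0.
  have := free (fun i => w 0 (g i)); rewrite !sumK.
  under eq_bigr do rewrite gfK.
  under [X in _ -> X = 0 -> _]eq_bigr do rewrite gfK.
  move=> /(_ s0 v0) wK; apply/rowP => k; rewrite mxE.
  by have := wK _ (fK k); rewrite gfK.
pose W : 'M[R]_(1 + 3, 4) := invmx (V : 'M[R]_4).
have VW : V *m W = 1%:M by exact: mulmxV.
have WV : W *m V = 1%:M by exact: mulVmx.
pose X x : 'rV[R]_(1 + 3) := row_mx 1%:M x.
pose l k x := (X x *m W) 0 k.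
have lE k x : l k x = dot (\row_j W (rshift 1 j) k) x + W (lshift 3 0) k.
  rewrite /l mxE big_split_ord /= big_ord1 addrC; congr (_ + _).
    by apply: eq_bigr => j _; rewrite row_mxEr mxE mulrC.
  by rewrite row_mxEl mxE eqxx mul1r.
have lX x : \row_k l k x *m V = X x.
  rewrite (_ : \row_k l k x = X x *m W); last by apply/rowP => k; rewrite mxE.
  by rewrite -mulmxA WV mulmx1.
exists (fun i => l (g i)), (fun i => \row_j W (rshift 1 j) (g i)); split.
- by move=> i; exists (W (lshift 3 0) (g i)).
- move=> x; rewrite sumK; under eq_bigr do rewrite gfK.
  have := lX x; rewrite wV => H; have [/matrixP/(_ 0 0) + _] := eq_row_mx H.
  rewrite [X in _ = X]mxE eqxx mulr1n => E; rewrite -[RHS]E mxE eqxx mulr1n.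
  by apply: eq_bigr => k _; rewrite mxE.
- move=> x; rewrite sumK; under eq_bigr do rewrite gfK.
  have := lX x; rewrite wV => H; have [_ E] := eq_row_mx H; rewrite -[LHS]E.
  by apply: eq_bigr => k _; rewrite mxE.
- move=> w i w1 iK; rewrite -[in RHS](fgK i iK).
  have E : X (\sum_(j in K) w j *: vtx j) = (\row_k w (f k)) *m V.
    rewrite wV /X; congr row_mx.
      by under eq_bigr do rewrite mxE; rewrite -sumK w1.
    by rewrite sumK; apply: eq_bigr => k _; rewrite mxE.
  by rewrite /l E -mulmxA VW mulmx1 mxE.
Qed.

Variables (K : {set 'I_(nvtx M)}) (lam : 'I_(nvtx M) -> 'rV[R]_3 -> R)
  (al : 'I_(nvtx M) -> 'rV[R]_3).
Hypothesis bK : barycentric K lam al.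

Lemma hullP x : hull K x <-> forall i, i \in K -> 0 <= lam i x.
Proof.
have [_ l1 lx lw] := bK; split=> [[w [w0 w1 ->]] i iK|l0].
  by rewrite lw.
exists (fun i => if i \in K then lam i x else 0); split.
- by move=> i; case: ifP => // /l0.
- by rewrite -[RHS](l1 x); apply: eq_bigr => i ->.
- by rewrite [LHS](lx x); apply: eq_bigr => i ->.
Qed.

Lemma barycentric_smooth i : smooth (lam i).
Proof. by have [/(_ i)/affine_smooth] := bK. Qed.

Lemma barycentric_neq0 i : #|K| = 4%N -> i \in K -> al i != 0.
Proof.
move=> K4 iK; have [/(_ i)[b aE] _ _ lw] := bK.
have [j jK ji] : exists2 j, j \in K & j != i.
  have /card_gt0P[j] : (0 < #|K :\ i|)%N.
    by have := cardsD1 i K; rewrite K4 iK add1n => -[<-].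
  by rewrite !inE => /andP[ji jK]; exists j.
have lv k : k \in K -> lam i (vtx k) = (i == k)%:R.
  move=> kK; rewrite -(lw (fun l => (l == k)%:R) i) //.
  - congr (lam i _); rewrite (bigD1 k)//= eqxx scale1r big1 ?addr0//.
    by move=> l /andP[_ /negbTE ->]; rewrite scale0r.
  - rewrite (bigD1 k)//= eqxx big1 ?addr0// => l /andP[_ /negbTE ->] //.
apply/negP => /eqP a0.
have c x : lam i x = b by rewrite aE a0 /dot big1 ?add0r// => k _; rewrite mxE mul0r.
have := lv i iK; have := lv j jK; rewrite !c eqxx eq_sym (negbTE ji) => -> /esym /eqP.
by rewrite oner_eq0.
Qed.

(** At a point of the hull where [lam i] vanishes, moving against its gradient
leaves the hull. *)
Lemma insideP x : #|K| = 4%N -> inside K x <-> forall i, i \in K -> 0 < lam i x.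
Proof.
move=> K4; split=> [xK i iK|l0].
  have /hullP/(_ i iK) : hull K x by exact: interior_subset xK.
  rewrite le_eqVlt => /orP[/eqP E|//]; exfalso.
  have a0 := barycentric_neq0 K4 iK.
  have [/(_ i)aff _ _ _] := bK.
  have cv : (x + s *: al i) @[s --> (0 : R)] --> x.
    rewrite -[X in _ --> X]addr0 -[in X in _ --> X](scale0r (al i)).
    by apply: cvgD; [exact: cvg_cst|apply: cvgZr_tmp; exact: cvg_id].
  have /nbhs_ballP[d /= d0 Hd] := cv _ xK.
  have Hs : hull K (x + (- (d / 2)) *: al i).
    apply: Hd; rewrite /ball /= sub0r opprK ger0_norm ?divr_ge0 ?ltW//.
    by rewrite ltr_pdivrMr// mulr2n mulrDr mulr1 ltrDl.
  have s0 : - (d / 2) < 0 by rewrite oppr_lt0 divr_gt0.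
  move/hullP: Hs => /(_ i iK); rewrite (affine_line _ _ _ aff) -E add0r.
  by rewrite leNgt nmulr_rlt0// dotxx_gt0.
have : \forall y \near x, forall i, i \in K -> 0 < lam i y.
  apply: (@filter_forall _ _ (fun i y => i \in K -> 0 < lam i y) _ (nbhs_filter x)) => i.
  have [iK|niK] := boolP (i \in K); last first.
    by apply: nearW.
  have cl : {for x, continuous (lam i)}.
    by apply: smooth_continuous; exact: barycentric_smooth.
  have : \forall y \near x, 0 < lam i y by exact: (cl _ (lt_nbhsr (l0 i iK))).
  by apply: filterS.
by apply: filterS => y ly; apply/hullP => i iK; apply: ltW; exact: ly.
Qed.

End Barycentric.

Section Cutoff.
Context {R : realType} (M : mesh R) (Om : set 'rV[R]_3).
Hypotheses (Om_domain : bounded_domain Om) (M_Om : triangulation M Om).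
Implicit Types (x : 'rV[R]_3) (K L : {set 'I_(nvtx M)}).

Lemma cell_barycentric K : K \in cells M -> exists lam al, barycentric K lam al.
Proof. by have [H _ _ _] := M_Om => /H[]; exact: barycentric_exists. Qed.

Lemma cell_card K : K \in cells M -> #|K| = 4%N.
Proof. by have [H _ _ _] := M_Om => /H[]. Qed.

Lemma inside_sub K : K \in cells M -> inside K `<=` Om.
Proof.
move=> KM; have [_ _ cE <-] := M_Om.
by apply: interiorS => x xK; rewrite cE; exists K.
Qed.

(** Two cells meet in the hull of their common vertices, where the barycentric
coordinate at a vertex of [K] that [L] lacks is zero. *)
Lemma inside_disjoint K L x : K \in cells M -> L \in cells M ->
  inside K x -> inside L x -> K = L.
Proof.
move=> KM LM xK xL; apply/eqP; apply: contrapT => /negP KL.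
have [lam [al bK]] := cell_barycentric KM.
have K4 := cell_card KM; have L4 := cell_card LM.
have [_ H _ _] := M_Om.
have : hull (K :&: L) x by rewrite -H//; split; exact: interior_subset.
move=> [w [_ w1 xE]].
have [k kK kL] : exists2 k, k \in K & k \notin L.
  have : ~~ (K \subset L).
    by apply: contra KL => KL; rewrite eqEcard KL K4 L4.
  by move=> /subsetPn[k kK kL]; exists k.
have /(insideP bK x K4)/(_ k kK) := xK.
pose w' i := if i \in L then w i else 0.
have s1 : \sum_(i in K) w' i = 1.
  rewrite -w1 [in LHS]big_mkcond [in RHS]big_mkcond; apply: eq_bigr => i _.
  by rewrite /w' inE; case: (i \in K); case: (i \in L).
have <- : \sum_(i in K) w' i *: vtx i = x.
  rewrite xE [in LHS]big_mkcond [in RHS]big_mkcond; apply: eq_bigr => i _.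
  by rewrite /w' inE; case: (i \in K); case: (i \in L); rewrite ?scale0r.
have [_ _ _ ->//] := bK.
by rewrite /w' (negbTE kL) ltxx.
Qed.

(** The product over the vertices of [flat 0 (n lam i - 1)] is supported where all
[lam i] are at least [1/n], and tends to 1 in the interior. These functions turn
identities tested against functions supported in a cell into identities on the
whole cell. *)
Lemma cell_cutoff K : K \in cells M ->
  exists (psi : nat -> 'rV[R]_3 -> R) (C : nat -> set 'rV[R]_3),
  [/\ forall n, smooth (psi n),
      forall n, compact (C n) /\ C n `<=` inside K,
      forall n x, ~ C n x -> psi n x = 0,
      forall n x, `|psi n x| <= 1
    & forall x, inside K x -> psi n x @[n --> \oo] --> (1 : R)].
Proof.
move=> KM; have [lam [al bK]] := cell_barycentric KM.
have K4 := cell_card KM; have [oOm _ bOm _] := Om_domain.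
pose arg n i x := n%:R * lam i x - 1.
have sarg n i : smooth (arg n i).
  apply: smoothB; last exact: smooth_cst.
  by apply: smoothM; [exact: smooth_cst|exact: (barycentric_smooth bK)].
pose C n : set 'rV[R]_3 := \bigcap_(i in [set i | i \in K]) [set x | 0 <= arg n i x].
have Csub n : C n `<=` inside K.
  move=> x Cx; apply/(insideP bK x K4) => i iK.
  have := Cx i iK; rewrite /= /arg subr_ge0 => h.
  rewrite ltNge; apply/negP => l0.
  have := le_trans h (_ : _ <= 0); rewrite ler10 => /(_ _)/notF; apply.
  by rewrite mulr_ge0_le0.
exists (fun n x => \prod_(i in K) flat 0 (arg n i x)), C; split.
- by move=> n; apply: smooth_prod => i _; apply: smooth_flat.
- move=> n; split => //.
  apply: bounded_closed_compact.
    have [A [rA HA]] := bOm; exists A; split => // y Ay x Cx.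
    by apply: (HA y Ay); apply: (inside_sub KM); exact: Csub Cx.
  apply: closed_bigI => i iK.
  apply: (@preimage_closed _ _ (arg n i) [set y | 0 <= y]); last exact: closed_ge.
  by move=> x _; apply: smooth_continuous.
- move=> n x nC.
  have [i iK ni] : exists2 i, i \in K & arg n i x < 0.
    apply: contrapT => H; apply: nC => i iK /=; rewrite leNgt; apply/negP => l.
    by apply: H; exists i.
  by rewrite (bigD1 i)//= {1}/flat ltNge (ltW ni) mul0r.
- move=> n x; rewrite ger0_norm; last by apply: prodr_ge0 => i _; exact: flat_ge0.
  by apply: prodr_ile1 => i _; rewrite flat_ge0 flat0_le1.
- move=> x xK.
  rewrite -[X in _ --> X](_ : \prod_(i in K) 1 = 1); last by rewrite big1.
  apply: cvg_big => [|i iK]; first exact: mul_continuous.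
  have l0 : 0 < lam i x by exact: (insideP bK x K4).1.
  apply: (cvg_comp _ _ _ flat0_cvgy).
  apply/cvgryPge => A; near=> n; rewrite /arg.
  rewrite lerBrDr -ler_pdivrMr//; near: n; exact: nbhs_infty_ger.
Unshelve. all: by end_near. Qed.

(** Outside the interiors of the cells, a point of [Om] has a vanishing barycentric
coordinate, so it lies on one of finitely many planes. *)
Lemma skeleton_null :
  leb3.-negligible (vec3 @^-1` (Om `\` \bigcup_(K in [set K | K \in cells M]) inside K)).
Proof.
have [oOm _ bOm _] := Om_domain.
have /choice[lam] (K : {set 'I_(nvtx M)}) : exists lam, exists al,
    K \in cells M -> barycentric K lam al.
  have [KM|nKM] := boolP (K \in cells M).
    by have [lam [al H]] := cell_barycentric KM; exists lam, al.
  by exists (fun _ _ => 0), (fun=> 0).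
move=> /choice[al bK].
pose F (p : {set 'I_(nvtx M)} * 'I_(nvtx M)) : set 'rV[R]_3 :=
  if (p.1 \in cells M) && (p.2 \in p.1) then Om `&` [set x | lam p.1 p.2 x = 0] else set0.
have Fnull p : leb3.-negligible (vec3 @^-1` F p).
  rewrite /F; case: ifPn => [/andP[KM iK]|_]; last first.
    by rewrite preimage_set0; exact: negligible_set0.
  have [aff _ _ _] := bK _ KM.
  exact: (plane_null oOm bOm (barycentric_neq0 (bK _ KM) (cell_card KM) iK) (aff _)).
pose G n : set (measurableTypeR R * measurableTypeR R * measurableTypeR R) :=
  if unpickle n is Some p then vec3 @^-1` F p else set0.
have Gnull : leb3.-negligible (\bigcup_n G n).
  apply: negligible_bigcup => n; rewrite /G.
  by case: unpickle => [p|]; [exact: Fnull|exact: negligible_set0].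
apply: negligibleS Gnull => c [Omc nc].
have [K KM xK] : exists2 K, K \in cells M & hull K (vec3 c).
  have [_ _ cE _] := M_Om.
  have : closure Om (vec3 c) by exact: subset_closure.
  by rewrite cE.
have [i iK li] : exists2 i, i \in K & lam K i (vec3 c) = 0.
  apply: contrapT => H; apply: nc; exists K => //.
  apply/(insideP (bK K KM) _ (cell_card KM)) => i iK.
  rewrite lt_neqAle; apply/andP; split; last exact: (hullP (bK K KM) _).1.
  by apply/eqP => E; apply: H; exists i.
exists (pickle (K, i)) => //; rewrite /G pickleK /F /= KM iK /=.
by split.
Qed.

End Cutoff.

(** * Inner products in L^2 *)

Section Hilbert.
Context d (T : measurableType d) (R : realType) (mu : {measure set T -> \bar R}).
Implicit Types f g h : T -> R.
Local Notation L2s := (Lfun mu 2%:E).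

Definition inner f g : R := \int[mu]_x (f x * g x).

Lemma Lfun_measurable f : f \in L2s -> measurable_fun setT f.
Proof. by rewrite inE => /andP[/[!inE]]. Qed.

Lemma LfunD f g : f \in L2s -> g \in L2s -> (fun x => f x + g x) \in L2s.
Proof.
by have [_ H] := @Lfun_addr_closed _ _ _ mu 2%:E (lee1n 2); exact: H.
Qed.

Lemma LfunZ c f : f \in L2s -> (fun x => c * f x) \in L2s.
Proof.
move=> Hf; have := @Lfun_scale _ _ _ mu f c 2 (ler1n _ 2) Hf.
by rewrite (_ : c \o* f = fun x => c * f x)//; apply/funext => x; rewrite /= mulrC.
Qed.

Lemma inner_integrable f g : f \in L2s -> g \in L2s ->
  mu.-integrable setT (EFin \o (fun x => f x * g x)).
Proof. by move=> Hf Hg; apply/Lfun1_integrable; exact: Lfun2_mul_Lfun1. Qed.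

Lemma innerE f g : f \in L2s -> g \in L2s ->
  ((inner f g)%:E = \int[mu]_x (f x * g x)%:E)%E.
Proof.
by move=> Hf Hg; rewrite fineK//; apply: integrable_fin_num => //; exact: inner_integrable.
Qed.

Lemma innerC f g : inner f g = inner g f.
Proof. by apply: eq_Rintegral => x _; rewrite mulrC. Qed.

Lemma innerDl f g h : f \in L2s -> g \in L2s -> h \in L2s ->
  inner (fun x => f x + g x) h = inner f h + inner g h.
Proof.
move=> Hf Hg Hh; rewrite /inner -RintegralD//; [|exact: inner_integrable..].
by apply: eq_Rintegral => x _; rewrite mulrDl.
Qed.

Lemma innerZl c f h : f \in L2s -> h \in L2s ->
  inner (fun x => c * f x) h = c * inner f h.
Proof.
move=> Hf Hh; rewrite /inner -RintegralZl//; last exact: inner_integrable.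
by apply: eq_Rintegral => x _; rewrite mulrA.
Qed.

Lemma innerDr f g h : f \in L2s -> g \in L2s -> h \in L2s ->
  inner h (fun x => f x + g x) = inner h f + inner h g.
Proof. by move=> Hf Hg Hh; rewrite !(innerC h) innerDl. Qed.

Lemma innerZr c f h : f \in L2s -> h \in L2s ->
  inner h (fun x => c * f x) = c * inner h f.
Proof. by move=> Hf Hh; rewrite !(innerC h) innerZl. Qed.

Lemma Lnorm_fin f : f \in L2s -> Lnorm mu 2%:E (EFin \o f) \is a fin_num.
Proof. by rewrite inE => /andP[_ /[!inE]]; rewrite ge0_fin_numE ?Lnorm_ge0. Qed.

Lemma cauchy_schwarz f g : f \in L2s -> g \in L2s ->
  `|inner f g| <= fine (Lnorm mu 2%:E (EFin \o f)) * fine (Lnorm mu 2%:E (EFin \o g)).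
Proof.
move=> Hf Hg; rewrite -lee_fin EFinM !fineK ?Lnorm_fin//.
have mf := Lfun_measurable Hf; have mg := Lfun_measurable Hg.
have two : 2^-1 + 2^-1 = 1 :> R by rewrite [RHS]splitr !div1r.
apply: le_trans (hoelder mu mf mg (ltr0n _ 2) (ltr0n _ 2) two).
rewrite Lnorm1 -abse_EFin (innerE Hf Hg).
exact: (le_abse_integral mu measurableT (measurable_int _ (inner_integrable Hf Hg))).
Qed.

(** Otherwise the nonnegative function [t |-> (g + t f, g + t f)] would be affine
and not constant. *)
Lemma inner_null f g : f \in L2s -> g \in L2s -> inner f f = 0 -> inner f g = 0.
Proof.
move=> Hf Hg ff0.
have key t : 0 <= inner g g + 2 * t * inner f g.
  have Htf := LfunZ t Hf; have Hs := LfunD Hg Htf.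
  have -> : inner g g + 2 * t * inner f g =
      inner (fun x => g x + t * f x) (fun x => g x + t * f x).
    by rewrite innerDl// !innerDr// !innerZl// !innerZr// ff0 (innerC f g); ring.
  by apply: Rintegral_ge0 => x _; rewrite -expr2 sqr_ge0.
apply/eqP; apply: contrapT => /negP fg0.
have := key (- (inner g g + 1) / (2 * inner f g)).
rewrite (_ : 2 * _ * _ = - (inner g g + 1)); last by field.
by lra.
Qed.

Lemma bounded_Lfun (A : set T) f (K : R) :
  measurable A -> (mu A < +oo)%E -> measurable_fun setT f ->
  (forall x, `|f x| <= K) -> (forall x, ~ A x -> f x = 0) -> f \in L2s.
Proof.
move=> mA fA mf fK f0.
rewrite inE; apply/andP; split; rewrite inE //=.
rewrite /finite_norm unlock poweR_lty//.
have mf2 : measurable_fun setT (fun x => `|f x| `^ 2).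
  apply: (measurableT_comp (measurable_powR _)) => //.
  exact: measurableT_comp.
have : mu.-integrable setT (EFin \o (fun x => `|f x| `^ 2)).
  apply: (bounded_support_integrable (K := K `^ 2) mA fA mf2).
    move=> x; rewrite ger0_norm ?powR_ge0//.
    by rewrite ge0_ler_powR// ?nnegrE// (le_trans _ (fK x)).
  by move=> x /f0 ->; rewrite normr0 powR0.
move=> /integrableP[_]; apply: le_lt_trans.
apply: ge0_le_integral => //=.
- by apply/measurable_EFinP; exact: mf2.
- by apply/measurable_EFinP; apply: measurableT_comp.
- by move=> x _; rewrite lee_fin ler_norm.
Qed.

Lemma inner_cvg {I : Type} (F : set_system I) {FF : Filter F} (h : I -> T -> R) f g :
  f \in L2s -> g \in L2s -> (\forall r \near F, h r \in L2s) ->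
  Lnorm mu 2%:E (EFin \o (fun x => h r x - g x)) @[r --> F] --> 0%E ->
  inner (h r) f @[r --> F] --> inner g f.
Proof.
move=> Hf Hg Hh /fine_cvgP[_ /cvgrPdist_lt H].
set Nf := fine (Lnorm mu 2%:E (EFin \o f)).
have Nf0 : 0 <= Nf by apply: fine_ge0; exact: Lnorm_ge0.
apply/cvgrPdist_lt => eps eps0.
have e0 : 0 < eps / (Nf + 1) by rewrite divr_gt0// ltr_wpDl.
near=> r.
have Hr : h r \in L2s by near: r.
have HN : `|0 - fine (Lnorm mu 2%:E (EFin \o (fun x => h r x - g x)))| < eps / (Nf + 1).
  by near: r; exact: H.
have Hng : (fun x => -1 * g x) \in L2s by exact: LfunZ.
have Hd : (fun x => h r x - g x) \in L2s.
  by under eq_fun do rewrite -mulN1r; exact: LfunD.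
have dE : inner (fun x => h r x - g x) f = inner (h r) f - inner g f.
  under [X in inner X f]eq_fun do rewrite -mulN1r.
  by rewrite innerDl// innerZl// mulN1r.
rewrite distrC -dE (le_lt_trans (cauchy_schwarz Hd Hf))// -/Nf.
move: HN; rewrite sub0r normrN ger0_norm; last by apply: fine_ge0; exact: Lnorm_ge0.
rewrite ltr_pdivlMr ?ltr_wpDl// => /le_lt_trans; apply.
by rewrite mulrDr mulr1 lerDl fine_ge0 ?Lnorm_ge0.
Unshelve. all: by end_near. Qed.

(** Dominated convergence, with the limit as dominating function. *)
Lemma inner_dominated f h (phi : nat -> T -> R) (N : set T) :
  f \in L2s -> h \in L2s -> (forall n, measurable_fun setT (phi n)) ->
  mu.-negligible N ->
  (forall x, ~ N x -> phi n x @[n --> \oo] --> h x) ->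
  (forall n x, ~ N x -> `|phi n x| <= `|h x|) ->
  (forall n, inner f (phi n) = 0) -> inner f h = 0.
Proof.
move=> Hf Hh mphi [M [mM M0 NM]] phih phi_le zero.
have mf := Lfun_measurable Hf.
have ifh := inner_integrable Hf Hh.
have [] := @dominated_convergence _ _ _ mu setT measurableT
  (fun n => EFin \o (fun x => f x * phi n x)) (EFin \o (fun x => f x * h x))
  (abse \o (EFin \o (fun x => f x * h x))).
- by move=> n; apply/measurable_EFinP; apply: measurable_funM.
- exact: measurable_int ifh.
- exists M; split => // x; apply: contra_notP => /= nM _.
  have Nx : ~ N x by move=> /NM.
  apply: cvg_EFin; first exact: nearW.
  by apply: cvgMr; exact: phih.
- exact: integrable_abse.
- exists M; split => // x; apply: contra_notP => /= nM n _.
  have Nx : ~ N x by move=> /NM.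
  by rewrite lee_fin !normrM ler_wpM2l// phi_le.
move=> _ _ C.
have C0 : (fun n => \int[mu]_x (f x * phi n x)%:E)%E @ \oo --> (inner f h)%:E.
  by rewrite innerE.
have : (inner f (phi n)) @[n --> \oo] --> inner f h.
  exact: (fine_cvg C0).
under eq_fun do rewrite zero.
move=> /cvg_lim => <- //; exact: lim_cst.
Qed.

End Hilbert.

(** * L^2 fields on the domain *)

Section Restriction.
Context {R : realType}.
Local Notation T3 := (measurableTypeR R * measurableTypeR R * measurableTypeR R)%type.
Variable Om : set 'rV[R]_3.
Implicit Types (x : 'rV[R]_3) (f g h : 'rV[R]_3 -> R) (u v w : 'rV[R]_3 -> 'rV[R]_3).

(** [ip Om] is the [L^2] inner product of the extensions by zero. *)
Definition ext0 f : T3 -> R := (f \_ Om) \o vec3.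

Lemma ext0E f c : ext0 f c = if vec3 c \in Om then f (vec3 c) else 0.
Proof. by []. Qed.

Lemma volintE f : volint Om f = \int[leb3]_c ext0 f c.
Proof. by rewrite /volint Rintegral_mkcond. Qed.

Lemma ipE f g : ip Om f g = inner leb3 (ext0 f) (ext0 g).
Proof.
rewrite /ip volintE; apply: eq_Rintegral => c _; rewrite !ext0E.
by case: ifP => // _; rewrite mulr0.
Qed.

Lemma ext0D f g : ext0 (fun x => f x + g x) = fun c => ext0 f c + ext0 g c.
Proof. by apply/funext => c; rewrite !ext0E; case: ifP; rewrite ?addr0. Qed.

Lemma ext0Z (a : R) f : ext0 (fun x => a * f x) = fun c => a * ext0 f c.
Proof. by apply/funext => c; rewrite !ext0E; case: ifP; rewrite ?mulr0. Qed.

Lemma L2E f : L2 Om f = (ext0 f \in Lfun leb3 2%:E) :> Prop.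
Proof. by []. Qed.

Lemma L2D f g : L2 Om f -> L2 Om g -> L2 Om (fun x => f x + g x).
Proof. by rewrite !L2E ext0D; exact: LfunD. Qed.

Lemma L2Z (a : R) f : L2 Om f -> L2 Om (fun x => a * f x).
Proof. by rewrite !L2E ext0Z; exact: LfunZ. Qed.

Lemma ipC f g : ip Om f g = ip Om g f.
Proof. by rewrite !ipE innerC. Qed.

Lemma ipDl f g h : L2 Om f -> L2 Om g -> L2 Om h ->
  ip Om (fun x => f x + g x) h = ip Om f h + ip Om g h.
Proof. by move=> Hf Hg Hh; rewrite !ipE ext0D innerDl. Qed.

Lemma ipZl (a : R) f h : L2 Om f -> L2 Om h ->
  ip Om (fun x => a * f x) h = a * ip Om f h.
Proof. by move=> Hf Hh; rewrite !ipE ext0Z innerZl. Qed.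

Lemma ipDr f g h : L2 Om f -> L2 Om g -> L2 Om h ->
  ip Om h (fun x => f x + g x) = ip Om h f + ip Om h g.
Proof. by move=> Hf Hg Hh; rewrite !(ipC h) ipDl. Qed.

Lemma L2_0 : L2 Om (fun=> 0).
Proof.
rewrite /L2 (_ : _ \o _ = fun=> 0); last first.
  by apply/funext => c; rewrite -/(ext0 _) ext0E; case: ifP.
by have [] := @Lfun_addr_closed _ _ _ (@leb3 R) 2%:E (lee1n 2).
Qed.

Lemma ip0l h : ip Om (fun=> 0) h = 0.
Proof. by rewrite /ip /volint /Rintegral integral0_eq// => c _; rewrite mul0r. Qed.

Lemma ip0r h : ip Om h (fun=> 0) = 0.
Proof. by rewrite ipC ip0l. Qed.

Lemma L2_sum (I : Type) (r : seq I) (P : pred I) (F : I -> 'rV[R]_3 -> R) :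
  (forall k, P k -> L2 Om (F k)) -> L2 Om (fun x => \sum_(k <- r | P k) F k x).
Proof.
move=> HF; elim: r => [|k r IH].
  by under eq_fun do rewrite big_nil; exact: L2_0.
under eq_fun do rewrite big_cons; case Pk : (P k) => //.
by apply: L2D => //; apply: HF.
Qed.

Lemma ip_sumr (I : Type) (r : seq I) (P : pred I) (F : I -> 'rV[R]_3 -> R) h :
  L2 Om h -> (forall k, P k -> L2 Om (F k)) ->
  ip Om h (fun x => \sum_(k <- r | P k) F k x) = \sum_(k <- r | P k) ip Om h (F k).
Proof.
move=> Hh HF; elim: r => [|k r IH].
  by rewrite big_nil; under [X in ip _ _ X]eq_fun do rewrite big_nil; exact: ip0r.
rewrite big_cons; under [X in ip _ _ X]eq_fun do rewrite big_cons.
case Pk : (P k) => //; rewrite ipDr ?IH//; first exact: HF.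
exact: L2_sum.
Qed.

Lemma ip_null f g : L2 Om f -> L2 Om g -> ip Om f f = 0 -> ip Om f g = 0.
Proof. by move=> Hf Hg; rewrite !ipE; exact: inner_null. Qed.

Lemma ip_ge0 f : 0 <= ip Om f f.
Proof. by rewrite ipE; apply: Rintegral_ge0 => x _; rewrite -expr2 sqr_ge0. Qed.

Lemma ip_cvg {I : Type} (F : set_system I) {FF : Filter F} (h : I -> 'rV[R]_3 -> R) f g :
  L2 Om f -> L2 Om g -> (\forall r \near F, L2 Om (h r)) ->
  L2norm Om (fun x => h r x - g x) @[r --> F] --> 0%E ->
  ip Om (h r) f @[r --> F] --> ip Om g f.
Proof.
move=> Hf Hg Hh H; under eq_fun do rewrite ipE; rewrite ipE.
apply: inner_cvg => //.
rewrite (_ : (fun r => _) = fun r => L2norm Om (fun x => h r x - g x))//.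
apply/funext => r; rewrite /L2norm; congr (Lnorm _ _ (_ \o _)).
by apply/funext => c; rewrite -/(ext0 _) !ext0E; case: ifP => // _; rewrite subr0.
Qed.

Lemma eq_ip f f' g g' : (forall x, Om x -> f x * g x = f' x * g' x) ->
  ip Om f g = ip Om f' g'.
Proof. by move=> H; apply: eq_Rintegral => c; rewrite inE => /H. Qed.

Lemma ipvE u v : L2v Om u -> L2v Om v ->
  ipv Om u v = \sum_(i < 3) ip Om (component u i) (component v i).
Proof.
move=> Hu Hv; rewrite /ipv volintE.
have -> : ext0 (fun x => dot (u x) (v x)) =
    fun c => \sum_(i < 3) ext0 (component u i) c * ext0 (component v i) c.
  apply/funext => c; rewrite ext0E; under eq_bigr do rewrite !ext0E.
  by case: ifP => // _; rewrite big1// => i _; rewrite mulr0.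
under eq_bigr do rewrite ipE; rewrite !big_ord_recl !big_ord0 !addr0.
under eq_Rintegral do rewrite !big_ord_recl !big_ord0 !addr0.
have H i := inner_integrable (Hu i) (Hv i).
have H12 := integrableD measurableT (H (lift ord0 ord0)) (H (lift ord0 (lift ord0 ord0))).
rewrite (RintegralD measurableT (H ord0) H12); congr (_ + _).
exact: (RintegralD measurableT (H (lift ord0 ord0)) (H (lift ord0 (lift ord0 ord0)))).
Qed.

Lemma L2vD u v : L2v Om u -> L2v Om v -> L2v Om (fun x => u x + v x).
Proof.
move=> Hu Hv i; rewrite (_ : component _ i = fun x => component u i x + component v i x).
  exact: L2D.
by apply/funext => x; rewrite /component mxE.
Qed.

Lemma L2vZ (a : R) u : L2v Om u -> L2v Om (fun x => a *: u x).
Proof.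
move=> Hu i; rewrite (_ : component _ i = fun x => a * component u i x).
  exact: L2Z.
by apply/funext => x; rewrite /component mxE.
Qed.

Lemma ipvC u v : ipv Om u v = ipv Om v u.
Proof.
by apply: eq_Rintegral => c _; apply: eq_bigr => i _; rewrite mulrC.
Qed.

Lemma ipvDl u v w : L2v Om u -> L2v Om v -> L2v Om w ->
  ipv Om (fun x => u x + v x) w = ipv Om u w + ipv Om v w.
Proof.
move=> Hu Hv Hw; rewrite !ipvE//; last exact: L2vD.
rewrite -big_split; apply: eq_bigr => i _ /=; rewrite -ipDl//.
by apply: eq_ip => x _; rewrite /component mxE.
Qed.

Lemma ipvZl (a : R) u w : L2v Om u -> L2v Om w ->
  ipv Om (fun x => a *: u x) w = a * ipv Om u w.
Proof.
move=> Hu Hw; rewrite !ipvE//; last exact: L2vZ.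
rewrite mulr_sumr; apply: eq_bigr => i _ /=; rewrite -ipZl//.
by apply: eq_ip => x _; rewrite /component mxE.
Qed.

Lemma ipv_null u v : L2v Om u -> L2v Om v -> ipv Om u u = 0 -> ipv Om u v = 0.
Proof.
move=> Hu Hv; rewrite !ipvE// => /eqP; rewrite psumr_eq0; last by move=> i _; exact: ip_ge0.
move=> /allP H; apply: big1 => i _; apply: ip_null => //.
by apply/eqP; apply: H; exact: mem_index_enum.
Qed.

Lemma ipv_cvg {I : Type} (F : set_system I) {FF : Filter F}
    (h : I -> 'rV[R]_3 -> 'rV[R]_3) u v :
  L2v Om u -> L2v Om v -> (\forall r \near F, L2v Om (h r)) ->
  (forall i, L2norm Om (fun x => component (h r) i x - component v i x) @[r --> F] --> 0%E) ->
  ipv Om (h r) u @[r --> F] --> ipv Om v u.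
Proof.
move=> Hu Hv Hh H; rewrite (ipvE Hv Hu).
have E : \forall r \near F,
    \sum_(i < 3) ip Om (component (h r) i) (component u i) = ipv Om (h r) u.
  by apply: filterS Hh => r Hr; rewrite ipvE.
apply: (cvg_trans (near_eq_cvg E)).
apply: cvg_big => [|i _]; first exact: add_continuous.
apply: ip_cvg => //; apply: filterS Hh => r; exact.
Qed.

End Restriction.

(** * Piecewise smooth functions and weak derivatives *)

Section Bounded.
Context {R : realType}.
Local Notation T3 := (measurableTypeR R * measurableTypeR R * measurableTypeR R)%type.
Implicit Types (x : 'rV[R]_3) (f g h : 'rV[R]_3 -> R).

Lemma smooth_bounded f (A : set 'rV[R]_3) : smooth f -> bounded_set A ->
  exists C, forall x, A x -> `|f x| <= C.
Proof.
move=> sf [N [_ HN]].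
pose B : set 'rV[R]_3 := [set x | `|x| <= N + 1].
have AB x : A x -> B x by apply: HN; rewrite ltrDl.
have [B0|/set0P B0] := eqVneq B set0.
  by exists 0 => x /AB; rewrite B0.
have cB : compact B.
  apply: bounded_closed_compact.
    exists (N + 1); split; first exact: num_real.
    by move=> M NM x /= Bx; rewrite (le_trans Bx)// ltW.
  apply: (@preimage_closed _ _ (fun x : 'rV[R]_3 => `|x|) [set y | y <= N + 1]).
    by move=> x _; exact: norm_continuous.
  exact: closed_le.
have cf : continuous f := smooth_continuous sf.
have cn : {within B, continuous (fun x => `|f x|)}.
  apply: continuous_subspaceT => x.
  by apply: (continuous_comp (cf x)); exact: norm_continuous.
have [x0 _ xmax] := compact_EVT_max B0 cB cn.
by exists `|f x0| => x /AB Bx; apply: xmax; rewrite inE.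
Qed.

Lemma L2_bounded (Om : set 'rV[R]_3) f C : open Om -> bounded_set Om ->
  measurable_fun [set: T3] (f \o vec3) -> (forall x, Om x -> `|f x| <= C) ->
  L2 Om f.
Proof.
move=> oOm bOm mf fC; have [N N0 NC] := bounded_cube bOm.
have mOm := open_vec3_measurable oOm.
rewrite L2E; apply: (bounded_Lfun (A := cube N) (K := Num.max C 0)).
- exact: measurable_cube.
- exact: cube_fin.
- rewrite (_ : ext0 Om f = (f \o vec3) \_ (vec3 @^-1` Om))//.
  apply/(measurable_restrict _ mOm measurableT); rewrite setTI.
  exact: measurable_funTS.
- move=> c; rewrite ext0E le_max; case: ifPn => [|_].
    by rewrite inE => /fC ->.
  by rewrite normr0 lexx orbT.
- by move=> c nc; rewrite ext0E; case: ifPn => //; rewrite inE => /NC.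
Qed.

Lemma L2_smooth (Om : set 'rV[R]_3) f : open Om -> bounded_set Om ->
  smooth f -> L2 Om f.
Proof.
move=> oOm bOm sf; have [C fC] := smooth_bounded sf bOm.
apply: (L2_bounded oOm bOm _ fC).
exact: diffble_measurable (smooth_diff sf).
Qed.

Lemma testfunS (A B : set 'rV[R]_3) f : A `<=` B -> testfun A f -> testfun B f.
Proof.
move=> AB [sf [C [cC CA f0]]]; split => //; exists C; split => //.
exact: subset_trans AB.
Qed.

End Bounded.

Section Piecewise.
Context {R : realType} (M : mesh R) (Om : set 'rV[R]_3).
Local Notation T3 := (measurableTypeR R * measurableTypeR R * measurableTypeR R)%type.
Hypotheses (Om_domain : bounded_domain Om) (M_Om : triangulation M Om).
Implicit Types (x : 'rV[R]_3) (f g h phi : 'rV[R]_3 -> R) (K : {set 'I_(nvtx M)}).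

Let oOm : open Om. Proof. by case: Om_domain. Qed.
Let bOm : bounded_set Om. Proof. by case: Om_domain. Qed.

Definition pwsmooth h := forall K, K \in cells M ->
  exists2 g, smooth g & forall x, inside K x -> h x = g x.

(** The interiors of the cells being disjoint, this is [F K] in each of them. *)
Definition glue (F : {set 'I_(nvtx M)} -> 'rV[R]_3 -> R) x : R :=
  \sum_(K in cells M) \1_(inside K) x * F K x.

Lemma glueE F K x : K \in cells M -> inside K x -> glue F x = F K x.
Proof.
move=> KM xK; rewrite /glue (bigD1 K)//= indicE mem_set// mul1r big1 ?addr0//.
move=> L /andP[LM LK]; rewrite indicE memNset ?mul0r// => xL.
by move: LK; rewrite (inside_disjoint M_Om LM KM xL xK) eqxx.
Qed.

Lemma L2_glue F : (forall K, K \in cells M -> smooth (F K)) -> L2 Om (glue F).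
Proof.
move=> sF; apply: L2_sum => K KM.
have [C FC] := smooth_bounded (sF K KM) bOm.
apply: (L2_bounded (C := Num.max C 0) oOm bOm).
  apply: measurable_funM; last exact: (diffble_measurable (smooth_diff (sF K KM))).
  have mK : measurable (vec3 @^-1` inside K : set T3).
    exact: (open_vec3_measurable (open_interior _)).
  exact: (@measurable_indic _ _ R setT _ mK).
move=> x Omx; rewrite indicE le_max; case: (x \in _).
  by rewrite mul1r FC.
by rewrite mul0r normr0 lexx orbT.
Qed.

(** Multiply [h] by the cut-off functions of the cells and let them tend to 1.
This is dominated convergence, as the skeleton is a null set. *)
Lemma weak_null e h : L2 Om e -> L2 Om h -> pwsmooth h ->
  (forall K phi, K \in cells M -> testfun (inside K) phi -> ip Om e phi = 0) ->
  ip Om e h = 0.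
Proof.
move=> He Hh hS e0.
have /choice[g gP] : forall K, exists g, K \in cells M ->
    smooth g /\ forall x, inside K x -> h x = g x.
  move=> K; have [KM|nKM] := boolP (K \in cells M); last by exists (fun=> 0).
  by have [g sg hg] := hS K KM; exists g.
have /choice[psiC psiCP] : forall K,
    exists pC : (nat -> 'rV[R]_3 -> R) * (nat -> set 'rV[R]_3),
    K \in cells M ->
  [/\ forall n, smooth (pC.1 n),
      forall n, compact (pC.2 n) /\ pC.2 n `<=` inside K,
      forall n x, ~ pC.2 n x -> pC.1 n x = 0,
      forall n x, `|pC.1 n x| <= 1
    & forall x, inside K x -> pC.1 n x @[n --> \oo] --> (1 : R)].
  move=> K; have [KM|nKM] := boolP (K \in cells M).
    by have [psi [C H]] := cell_cutoff Om_domain M_Om KM; exists (psi, C).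
  by exists (fun _ _ => 0, fun=> set0).
pose psi K := (psiC K).1; pose C K := (psiC K).2.
pose term n K x := psi K n x * g K x.
pose phi n x := \sum_(K in cells M) term n K x.
have sterm n K : K \in cells M -> smooth (term n K).
  by move=> KM; apply: smoothM; [have [H _ _ _ _] := psiCP K KM; exact: H|have [] := gP K KM].
have term0 n K x : K \in cells M -> ~ inside K x -> term n K x = 0.
  move=> KM nx; have [_ /(_ n)[_ CK] H _ _] := psiCP K KM.
  by rewrite /term /psi H ?mul0r// => /CK.
have phiE n K x : K \in cells M -> inside K x -> phi n x = psi K n x * h x.
  move=> KM xK; rewrite /phi (bigD1 K)//= big1 ?addr0.
    by have [_ ->] := gP K KM.
  move=> L /andP[LM LK]; apply: term0 => // xL.
  by move: LK; rewrite (inside_disjoint M_Om LM KM xL xK) eqxx.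
rewrite ipE.
pose N : set T3 := vec3 @^-1` (Om `\` \bigcup_(K in [set K | K \in cells M]) inside K).
have good c : ~ N c -> Om (vec3 c) -> exists2 K, K \in cells M & inside K (vec3 c).
  move=> nN Omc.
  have [[K KM cK]|H] := pselect ((\bigcup_(K in [set K | K \in cells M]) inside K) (vec3 c)).
    by exists K.
  by exfalso; apply: nN.
have null := skeleton_null Om_domain M_Om.
apply: (inner_dominated (phi := fun n => ext0 Om (phi n)) (N := N)) => //.
- move=> n; apply: (@Lfun_measurable _ _ _ leb3); rewrite -L2E.
  by apply: L2_sum => K KM; apply: L2_smooth => //; exact: sterm.
- move=> c nN; have [Omc|nOmc] := pselect (Om (vec3 c)); last first.
    under eq_fun do rewrite ext0E memNset//.
    by rewrite ext0E memNset//; exact: cvg_cst.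
  have [K KM cK] := good c nN Omc.
  under eq_fun do rewrite ext0E mem_set// (phiE _ _ _ KM cK).
  have [_ _ _ _ H] := psiCP K KM.
  have {}H := cvgMr_tmp (b := h (vec3 c)) (H _ cK); rewrite mul1r in H.
  rewrite ext0E mem_set//. exact: H.
- move=> n c nN; have [Omc|nOmc] := pselect (Om (vec3 c)); last first.
    by rewrite ext0E memNset// normr0.
  have [K KM cK] := good c nN Omc.
  rewrite !ext0E mem_set// (phiE _ _ _ KM cK) normrM ler_piMl//.
  by have [_ _ _ H _] := psiCP K KM; exact: H.
- move=> n; rewrite -ipE ip_sumr//; last first.
    by move=> K KM; apply: L2_smooth => //; exact: sterm.
  apply: big1 => K KM; apply: (e0 K) => //; split; first exact: sterm.
  have [_ /(_ n)[cC CK] H _ _] := psiCP K KM.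
  by exists (C K n); split => // x nx; rewrite /term /psi H ?mul0r.
Qed.

(** A weak derivative [d] is only known through its pairings with test functions;
inside the cells they agree with those of the classical derivatives [D K]. This
identifies [d] with the piecewise classical derivative. *)
Lemma weak_glue d D h : L2 Om d -> (forall K, K \in cells M -> smooth (D K)) ->
  (forall K phi, K \in cells M -> testfun (inside K) phi ->
    ip Om d phi = ip Om (D K) phi) ->
  L2 Om h -> pwsmooth h -> ip Om d h = ip Om (glue D) h.
Proof.
move=> Ld sD dD Lh sh; apply/eqP; rewrite -subr_eq0; apply/eqP.
have LD : L2 Om (glue D) by exact: L2_glue.
have LN : L2 Om (fun x => -1 * glue D x) by exact: L2Z.
rewrite -[- _]mulN1r -(ipZl (-1))// -ipDl//.
apply: weak_null => //; first exact: L2D.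
move=> K phi KM tphi; have [sphi [C [_ CK phi0]]] := tphi.
have Lphi : L2 Om phi by exact: L2_smooth.
rewrite ipDl// ipZl// mulN1r; apply/eqP; rewrite subr_eq0; apply/eqP.
rewrite (dD K)//; apply: eq_ip => x _.
have [Cx|/phi0 ->] := pselect (C x); last by rewrite !mulr0.
by rewrite (glueE _ KM)//; exact: CK.
Qed.

(** [P phi] has compact support, so its partial derivatives have integral zero. *)
Lemma local_parts K i f P phi : K \in cells M -> smooth P ->
  (forall x, inside K x -> f x = P x) -> testfun (inside K) phi ->
  ip Om f (partial i phi) = - ip Om (partial i P) phi.
Proof.
move=> KM sP fP [sphi [C [cC CK phi0]]].
have COm : C `<=` Om by apply: subset_trans CK _; exact: inside_sub.
have dphi0 x : ~ C x -> partial i phi x = 0 by exact: partial_outside.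
have -> : ip Om f (partial i phi) = ip Om P (partial i phi).
  apply: eq_ip => x _; have [Cx|nCx] := pselect (C x).
    by rewrite fP//; exact: CK.
  by rewrite dphi0// !mulr0.
apply/eqP; rewrite -addr_eq0; apply/eqP; rewrite !ipE /inner.
have H1 := inner_integrable (L2_smooth oOm bOm sP) (L2_smooth oOm bOm (smooth_partial i sphi)).
have H2 := inner_integrable (L2_smooth oOm bOm (smooth_partial i sP)) (L2_smooth oOm bOm sphi).
rewrite -(RintegralD measurableT H1 H2).
have sPphi := smoothM sP sphi.
have Pphi0 x : ~ C x -> P x * phi x = 0 by move=> /phi0 ->; rewrite mulr0.
have := integral_partial0 i sPphi cC Pphi0.
rewrite partialM; [|exact: smooth_diff..].
move=> /(congr1 fine) /= <-; apply: eq_Rintegral => c _.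
rewrite /= !patchE; case: ifPn => [_|]; first by rewrite [X in _ + X]mulrC.
rewrite notin_setE => nOm.
have nC : ~ C (vec3 c) by move=> /COm.
by rewrite !mul0r dphi0// phi0// mulr0 mul0r !addr0.
Qed.

End Piecewise.

(** * Functions of time with zero derivative *)

Section Time.
Context {R : realType}.
Implicit Types (t r T : R).

(** The filter along which difference quotients of functions on [[0, T]] are taken
in [is_dt]. *)
Definition interval_dnbhs T t : set_system R := within [set r | 0 <= r <= T] t^'.

Lemma interval_dnbhs_proper T t : 0 < T -> 0 <= t <= T ->
  ProperFilter (interval_dnbhs T t).
Proof.
move=> T0 /andP[t0 tT]; split; last exact: within_filter.
rewrite /interval_dnbhs /within /= => -[d /= d0 H].
have [tT'|Tt] := ltP t T.
  pose e := Num.min d (T - t); have e0 : 0 < e by rewrite lt_min d0 subr_gt0.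
  have ed : e <= d by rewrite ge_min lexx.
  have eT : e <= T - t by rewrite ge_min lexx orbT.
  apply: (H (t + e / 2)) => /=.
  - by rewrite opprD addrA subrr sub0r normrN gtr0_norm ?divr_gt0//; lra.
  - by rewrite gt_eqF// ltrDl divr_gt0.
  - by apply/andP; split; lra.
have {}tT : t = T by apply/eqP; rewrite eq_le tT Tt.
pose e := Num.min d t; have e0 : 0 < e by rewrite lt_min d0 tT.
have ed : e <= d by rewrite ge_min lexx.
have et : e <= t by rewrite ge_min lexx orbT.
apply: (H (t - e / 2)) => /=.
- by rewrite opprB addrC subrK gtr0_norm ?divr_gt0//; lra.
- by rewrite lt_eqF// gtrBl divr_gt0.
- by apply/andP; split; lra.
Qed.

(** The mean value theorem; at the end points only the continuity that follows from
the one-sided derivatives is used. *)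
Lemma derivative0_cst T (G : R -> R) :
  (forall t, 0 <= t <= T ->
    (r - t)^-1 * (G r - G t) @[r --> interval_dnbhs T t] --> (0 : R)) ->
  forall t, 0 <= t <= T -> G t = G 0.
Proof.
move=> H t /andP[t0 tT].
have key x eps : 0 <= x <= T -> 0 < eps -> exists2 d, 0 < d &
    forall r, 0 <= r <= T -> `|r - x| < d -> `|G r - G x| <= eps * `|r - x|.
  move=> xT eps0; have /cvgrPdist_le/(_ _ eps0)[d /= d0 Hd] := H x xT.
  exists d => // r rT rx.
  have [->|rnx] := eqVneq r x; first by rewrite !subrr normr0 mulr0.
  have := Hd r; rewrite /= distrC => /(_ rx rnx rT).
  rewrite sub0r normrN normrM normfV mulrC ler_pdivrMr// normr_gt0 subr_eq0//.
have cont x eps : 0 <= x <= T -> 0 < eps -> exists2 d, 0 < d &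
    forall r, 0 <= r <= T -> `|r - x| < d -> `|G x - G r| <= eps.
  move=> xT eps0; have [d d0 Hd] := key x eps xT eps0.
  exists (Num.min d 1); first by rewrite lt_min d0 ltr01.
  move=> r rT; rewrite lt_min => /andP[rd r1].
  by rewrite distrC (le_trans (Hd r rT rd))// ler_piMr// ltW.
move: t0; rewrite le_eqVlt => /orP[/eqP <-//|t0].
have inT x : x \in `]0, t[ -> 0 <= x <= T.
  by rewrite in_itv /= => /andP[x0 xt]; apply/andP; split; lra.
have dG x : x \in `]0, t[ -> is_derive x (1 : R) G 0.
  move=> xt; have xT := inT x xt.
  have C : (fun h : R => h^-1 *: ((G \o shift x) (h *: 1) - G x)) @ 0^' --> (0 : R).
    apply/cvgrPdist_le => eps eps0.
    have [d d0 Hd] := key x eps xT eps0.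
    near=> h.
    have h0 : h != 0 by near: h; exact: nbhs_dnbhs_neq.
    have hd : `|0 - h| < d by near: h; apply: nbhs_dnbhs; exact: nbhsx_ballx.
    have hx : `|0 - h| < Num.min x (t - x).
      near: h; apply: nbhs_dnbhs; apply: nbhsx_ballx.
      by move: xt; rewrite in_itv /= lt_min subr_gt0.
    rewrite /= [h%:A]mulr1 sub0r normrN normrM normfV mulrC ler_pdivrMr ?normr_gt0//.
    have := Hd (h + x); rewrite addrK; apply; last by move: hd; rewrite sub0r normrN.
    move: hx; have := xt; rewrite sub0r normrN lt_min !ltr_norml in_itv /=.
    by move=> /andP[? ?] /andP[/andP[? ?] /andP[? ?]]; apply/andP; split; lra.
  apply: DeriveDef; first by apply/cvg_ex; exists 0.
  exact: (cvg_lim _ C).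
have cG : {within `[0, t], continuous G}.
  apply/continuous_within_itvP => //; split.
  - move=> x xt; apply: differentiable_continuous; apply/derivable1_diffP.
    exact: (@ex_derive _ _ _ _ _ _ _ (dG x xt)).
  - apply/cvgrPdist_le => eps eps0.
    have [|d d0 Hd] := cont 0 eps _ eps0; first by rewrite lexx /=; lra.
    near=> r; apply: Hd.
      by apply/andP; split; [apply: ltW; near: r; exact: nbhs_right_gt|
        apply: le_trans tT; apply: ltW; near: r; exact: nbhs_right_lt].
    rewrite distrC; near: r; apply: cvg_at_right_filter (cvg_id) _ _.
    exact: nbhsx_ballx.
  - apply/cvgrPdist_le => eps eps0.
    have [|d d0 Hd] := cont t eps _ eps0; first by rewrite tT ltW.
    near=> r; apply: Hd.
      by apply/andP; split; [apply: ltW; near: r; exact: nbhs_left_gt|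
        apply: le_trans tT; apply: ltW; near: r; exact: nbhs_left_lt].
    rewrite distrC; near: r; apply: cvg_at_left_filter (cvg_id) _ _.
    exact: nbhsx_ballx.
have [c _ E] := MVT t0 dG cG.
by apply/eqP; rewrite -subr_eq0 E mul0r.
Unshelve. all: by end_near. Qed.

End Time.

(** * Divergence of Raviart-Thomas fields and curl of Nedelec fields *)

Section FiniteElements.
Context {R : realType} (M : mesh R) (Om : set 'rV[R]_3).
Hypotheses (Om_domain : bounded_domain Om) (M_Om : triangulation M Om).
Implicit Types (x : 'rV[R]_3) (f g h phi : 'rV[R]_3 -> R)
  (u v w z : 'rV[R]_3 -> 'rV[R]_3) (K : {set 'I_(nvtx M)}) (i j k : 'I_3).

Let oOm : open Om. Proof. by case: Om_domain. Qed.
Let bOm : bounded_set Om. Proof. by case: Om_domain. Qed.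

Definition pwpoly s f := forall K, K \in cells M ->
  exists2 p, polyfun s p & forall x, inside K x -> f x = p x.

(** The local part of the definition of [U_div]. *)
Definition raviart_thomas s u := forall K, K \in cells M ->
  exists p q, [/\ polyfunv s p, polyfun s q
    & forall x, inside K x -> u x = p x + q x *: x].

Lemma pwpoly_smooth s f : pwpoly s f -> pwsmooth M f.
Proof. by move=> H K /H[p /polyfun_smooth]; exists p. Qed.

Lemma polyfunN s f : polyfun s f -> polyfun s (fun x => - f x).
Proof. by move=> /(polyfunZ (-1)); under eq_fun do rewrite mulN1r. Qed.

Lemma polyfunB s f g : polyfun s f -> polyfun s g -> polyfun s (fun x => f x - g x).
Proof. by move=> Hf Hg; apply: polyfunD => //; exact: polyfunN. Qed.

Lemma polyfun_sum s (F : 'I_3 -> 'rV[R]_3 -> R) :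
  (forall i, polyfun s (F i)) -> polyfun s (fun x => \sum_(i < 3) F i x).
Proof.
move=> HF; elim: (index_enum _) => [|i r IH].
  by under eq_fun do rewrite big_nil; exact: polyfun0.
by under eq_fun do rewrite big_cons; apply: polyfunD.
Qed.

Lemma L2v_smooth v : (forall i, smooth (component v i)) -> L2v Om v.
Proof. by move=> sv i; apply: L2_smooth. Qed.

Lemma component_grad i phi : component (grad phi) i = partial i phi.
Proof. by apply/funext => x; rewrite /component mxE. Qed.

Lemma smooth_grad i phi : smooth phi -> smooth (component (grad phi) i).
Proof. by rewrite component_grad; exact: smooth_partial. Qed.

Lemma L2v_grad phi : smooth phi -> L2v Om (grad phi).
Proof. by move=> sphi; apply: L2v_smooth => i; exact: smooth_grad. Qed.

Lemma curl_grad phi : smooth phi -> curl (grad phi) = fun=> 0.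
Proof.
move=> sphi; apply/funext => x; apply/rowP => i; rewrite !mxE !component_grad.
by rewrite partial_comm// subrr.
Qed.

(** On a cell, the divergence of [p + q x] is [div p + 3 q + x . grad q], whose
degree is at most [s]. *)
Lemma raviart_thomas_div s u : raviart_thomas s u -> forall K, K \in cells M ->
  exists P : 'I_3 -> 'rV[R]_3 -> R,
  [/\ forall i, smooth (P i), forall i x, inside K x -> component u i x = P i x
    & polyfun s (fun x => \sum_(i < 3) partial i (P i) x)].
Proof.
move=> uRT K /uRT [p [q [ps qs uE]]].
exists (fun i x => component p i x + q x * x 0 i); split.
- move=> i; apply: smoothD; first exact: polyfun_smooth (ps i).
  by apply: smoothM; [exact: polyfun_smooth qs|exact: smooth_coord].
- by move=> i x xK; rewrite /component uE// !mxE.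
apply: polyfun_sum => i.
have sq := polyfun_smooth qs; have sp := polyfun_smooth (ps i).
have E : partial i (fun x => component p i x + q x * x 0 i) =
    fun x => partial i (component p i) x + (q x + x 0 i * partial i q x).
  rewrite partialD; [|exact: smooth_diff|].
    apply/funext => x; rewrite partialM; [|exact: smooth_diff|exact: diffble_coord].
    by rewrite partial_coord eqxx mulr1.
  by apply: smooth_diff; apply: smoothM => //; exact: smooth_coord.
rewrite E; apply: polyfunD; first exact: polyfun_partial (ps i).
by apply: polyfunD => //; exact: polyfun_mul_partial.
Qed.

(** The distributional divergence has the classical one as its restriction to each
cell, so that piecewise smooth functions do not distinguish it from a piecewise
polynomial. *)
Lemma weak_div_pwpoly s u : L2v Om u -> raviart_thomas s u ->
  exists dp, [/\ L2 Om dp, pwpoly s dp &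
    forall d, is_wdiv Om u d -> forall h, L2 Om h -> pwsmooth M h ->
      ip Om d h = ip Om dp h].
Proof.
move=> Lu uRT.
have /choice[P PP] : forall K, exists P : 'I_3 -> 'rV[R]_3 -> R, K \in cells M ->
  [/\ forall i, smooth (P i), forall i x, inside K x -> component u i x = P i x
    & polyfun s (fun x => \sum_(i < 3) partial i (P i) x)].
  move=> K; have [KM|nKM] := boolP (K \in cells M); last by exists (fun _ _ => 0).
  by have [P H] := raviart_thomas_div uRT KM; exists P.
pose D K x := \sum_(i < 3) partial i (P K i) x.
have sD K : K \in cells M -> smooth (D K).
  by move=> /PP[sP _ _]; apply: smooth_sum => i _; exact: smooth_partial.
pose dp := glue D.
have Ldp : L2 Om dp by exact: L2_glue.
exists dp; split => //.
  move=> K KM; have [_ _ Hp] := PP K KM; exists (D K) => // x xK.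
  exact: (glueE M_Om).
move=> d [Ld dP] h; apply: (weak_glue Om_domain M_Om) => // K phi KM tphi.
have [sphi _] := tphi.
have Lphi : L2 Om phi by exact: L2_smooth.
have [sP uP _] := PP K KM.
apply: oppr_inj; rewrite -dP; last exact: testfunS (inside_sub M_Om KM) tphi.
rewrite ipvE//; last exact: L2v_grad.
rewrite [ip Om (D K) phi]ipC ip_sumr//; last first.
  by move=> i _; apply: L2_smooth => //; exact: smooth_partial.
rewrite raddf_sum; apply: eq_bigr => i _.
by rewrite component_grad (local_parts Om_domain M_Om i KM (sP i) (uP i) tphi) ipC.
Qed.

End FiniteElements.

Section Curl.
Context {R : realType} (M : mesh R) (Om : set 'rV[R]_3).
Hypotheses (Om_domain : bounded_domain Om) (M_Om : triangulation M Om).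
Implicit Types (x : 'rV[R]_3) (f g h phi : 'rV[R]_3 -> R)
  (u v w z : 'rV[R]_3 -> 'rV[R]_3) (K : {set 'I_(nvtx M)}) (i j k : 'I_3).

Let oOm : open Om. Proof. by case: Om_domain. Qed.
Let bOm : bounded_set Om. Proof. by case: Om_domain. Qed.

(** The local part of the definition of [U_curl]. *)
Definition nedelec s z := forall K, K \in cells M ->
  exists p q, [/\ polyfunv s p, polyfunv s q
    & forall x, inside K x -> z x = p x + cross x (q x)].

(** The curl of [p + cross x q] is [curl p - 2 q - (x . grad) q + (div q) x], a
Raviart-Thomas field of the same order. *)
Lemma nedelec_curl s z : nedelec s z -> forall K, K \in cells M ->
  exists Z p q, [/\ forall i, smooth (component Z i),
    forall x, inside K x -> z x = Z x,
    polyfunv s p, polyfun s q & forall x, curl Z x = p x + q x *: x].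
Proof.
move=> zN K /zN [p [q [ps qs zE]]].
have sp i : smooth (component p i) by exact: polyfun_smooth (ps i).
have sq i : smooth (component q i) by exact: polyfun_smooth (qs i).
exists (fun x => p x + cross x (q x)).
exists (fun x => \row_k (curl p x 0 k - 2 * q x 0 k
  - \sum_(j < 3) x 0 j * partial j (component q k) x)).
exists (fun x => \sum_(j < 3) partial j (component q j) x).
have ZE i : component (fun x => p x + cross x (q x)) i = fun x =>
    component p i x +
    (x 0 (i + 1) * component q (i + 2) x - x 0 (i + 2) * component q (i + 1) x).
  by apply/funext => x; rewrite /component !mxE.
have sx i j : smooth (fun x => x 0 i * component q j x).
  by apply: smoothM => //; exact: smooth_coord.
split.
- by move=> i; rewrite ZE; apply: smoothD => //; apply: smoothB.
- exact: zE.
- move=> k; rewrite (_ : component _ k = fun x => curl p x 0 k - 2 * component q k x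
      - \sum_(j < 3) x 0 j * partial j (component q k) x); last first.
    by apply/funext => x; rewrite /component !mxE.
  apply: polyfunB; first apply: polyfunB.
  + rewrite (_ : (fun x => _) = fun x => partial (k + 1) (component p (k + 2)) x
        - partial (k + 2) (component p (k + 1)) x); last by apply/funext => x; rewrite mxE.
    by apply: polyfunB; exact: polyfun_partial (ps _).
  + exact: polyfunZ (qs k).
  + by apply: polyfun_sum => j; exact: polyfun_mul_partial (qs k).
- by apply: polyfun_sum => j; exact: polyfun_partial (qs j).
move=> x; apply/rowP => k; rewrite [LHS]mxE !mxE.
have dE i j : partial i (component (fun x => p x + cross x (q x)) j) x =
    partial i (component p j) x +
    ((x 0 (j + 1) * partial i (component q (j + 2)) x
      + component q (j + 2) x * (i == j + 1)%:R)
    - (x 0 (j + 2) * partial i (component q (j + 1)) x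
      + component q (j + 1) x * (i == j + 2)%:R)).
  rewrite ZE partialD; [|exact: smooth_diff|by apply: smooth_diff; exact: smoothB].
  congr (_ + _); rewrite partialB; [|exact: smooth_diff..].
  rewrite !partialM; first last.
  all: try exact: diffble_coord; try exact: smooth_diff.
  by rewrite !partial_coord.
rewrite !dE !big_ord_recl !big_ord0 /=.
(* The derivatives become variables before [ring] compares them. *)
pose D i j := partial i (component q j) x; pose P i j := partial i (component p j) x.
pose Q i := component q i x.
have DE i j : partial i (component q j) x = D i j by [].
have PE i j : partial i (component p j) x = P i j by [].
have QE i : component q i x = Q i by [].
have QE' i : q x 0 i = Q i by [].
rewrite !ord3_lift !DE !PE !QE !QE'; clear DE PE QE QE' dE; clearbody D P Q.
move: k; apply: ord3; rewrite ?ord3_add ?add0r ?ord3_add ?eqxx ?ord3_neq ?mulr1n ?mulr0n.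
all: move: (x 0 0) (x 0 1) (x 0 2) (Q 0) (Q 1) (Q 2) (D 0 0) (D 0 1) (D 0 2)
  (D 1 0) (D 1 1) (D 1 2) (D 2 0) (D 2 1) (D 2 2) (P 0 1) (P 0 2) (P 1 0) (P 1 2)
  (P 2 0) (P 2 1); clear; move=> *; ring.
Qed.

(** The test field [phi e_k] extracts the [k]-th component of the curl. *)
Lemma local_curl z c K Z phi k : is_wcurl Om z c -> L2v Om z -> K \in cells M ->
  (forall i, smooth (component Z i)) -> (forall x, inside K x -> z x = Z x) ->
  testfun (inside K) phi ->
  ip Om (component c k) phi = ip Om (component (curl Z) k) phi.
Proof.
move=> [Lc cP] Lz KM sZ zZ tphi; have [sphi [C [cC CK phi0]]] := tphi.
pose Phi x : 'rV[R]_3 := phi x *: delta_mx 0 k.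
have PhiE j : component Phi j = fun x => (k == j)%:R * phi x.
  by apply/funext => x; rewrite /component !mxE eqxx /= mulrC eq_sym.
have tPhi j : testfun Om (component Phi j).
  rewrite PhiE; split; first by apply: smoothM => //; exact: smooth_cst.
  exists C; split => // [|x /phi0 ->]; last by rewrite mulr0.
  by apply: subset_trans CK _; exact: (inside_sub M_Om).
have curlE i : component (curl Phi) i = fun x =>
    (k == i + 2)%:R * partial (i + 1) phi x + - (k == i + 1)%:R * partial (i + 2) phi x.
  apply/funext => x; rewrite /component mxE !PhiE !partialZ ?mulNr//; exact: smooth_diff.
have Ldphi i : L2 Om (partial i phi) by apply: L2_smooth => //; exact: smooth_partial.
have LdZ i j : L2 Om (partial i (component Z j)).
  by apply: L2_smooth => //; exact: smooth_partial.
have Lphi : L2 Om phi by exact: L2_smooth.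
have -> : ip Om (component c k) phi = ipv Om c Phi.
  by apply: eq_Rintegral => y _; rewrite /Phi dotZr dot_delta mulrC.
(* The weak curl of [z] moves the derivatives to the test field. *)
rewrite -cP//.
have LcurlPhi : L2v Om (curl Phi) by move=> i; rewrite curlE; apply: L2D; exact: L2Z.
have parts i j : ip Om (component z i) (partial j phi) =
    - ip Om (partial j (component Z i)) phi.
  apply: (local_parts Om_domain M_Om j KM (sZ i)) => // x xK.
  by rewrite /component zZ.
have termE i : ip Om (component z i) (component (curl Phi) i) =
    - ((k == i + 2)%:R * ip Om (partial (i + 1) (component Z i)) phi)
    + (k == i + 1)%:R * ip Om (partial (i + 2) (component Z i)) phi.
  rewrite curlE ipDr//; [|exact: L2Z..].
  rewrite ipC ipZl// ipC parts mulrN; congr (_ + _).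
  by rewrite ipC ipZl// ipC parts mulrNN.
rewrite ipvE//; under eq_bigr do rewrite termE.
have -> : ip Om (component (curl Z) k) phi =
    ip Om (partial (k + 1) (component Z (k + 2))) phi
    - ip Om (partial (k + 2) (component Z (k + 1))) phi.
  rewrite (_ : component _ k = fun x => partial (k + 1) (component Z (k + 2)) x
     + -1 * partial (k + 2) (component Z (k + 1)) x); last first.
    by apply/funext => x; rewrite /component mxE mulN1r.
  by rewrite ipDl// ?ipZl// ?mulN1r//; exact: L2Z.
pose A i j := ip Om (partial i (component Z j)) phi.
have AE i j : ip Om (partial i (component Z j)) phi = A i j by [].
rewrite !big_ord_recl big_ord0 !AE; clear -A k; clearbody A.
rewrite !ord3_lift.
move: k; apply: ord3; rewrite ?ord3_add ?add0r ?ord3_add ?eqxx ?ord3_neq ?mulr1n ?mulr0n.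
all: move: (A 0 0) (A 0 1) (A 0 2) (A 1 0) (A 1 1) (A 1 2) (A 2 0) (A 2 1) (A 2 2).
all: clear; move=> *; ring.
Qed.

(** As for the divergence, the distributional curl is the classical one in each
cell; by [nedelec_curl] this is a Raviart-Thomas field. *)
Lemma weak_curl_raviart_thomas s z : L2v Om z -> nedelec s z ->
  exists c', [/\ L2v Om c', raviart_thomas M s c' &
    forall c, is_wcurl Om z c -> forall w, L2v Om w ->
      (forall i, pwsmooth M (component w i)) -> ipv Om c w = ipv Om c' w].
Proof.
move=> Lz zN.
have /choice[Z ZP] : forall K, exists Z : 'rV[R]_3 -> 'rV[R]_3, K \in cells M ->
  exists p q, [/\ forall i, smooth (component Z i),
    forall x, inside K x -> z x = Z x,
    polyfunv s p, polyfun s q & forall x, curl Z x = p x + q x *: x].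
  move=> K; have [KM|nKM] := boolP (K \in cells M); last by exists (fun=> 0).
  by have [Z H] := nedelec_curl zN KM; exists Z.
pose D k K := component (curl (Z K)) k.
have sD k K : K \in cells M -> smooth (D k K).
  move=> /ZP[_ [_ [sZ _ _ _ _]]].
  rewrite /D (_ : component _ k = fun x => partial (k + 1) (component (Z K) (k + 2)) x
     - partial (k + 2) (component (Z K) (k + 1)) x); last first.
    by apply/funext => x; rewrite /component mxE.
  by apply: smoothB; exact: smooth_partial.
pose c' x : 'rV[R]_3 := \row_k glue (D k) x.
have c'E k : component c' k = glue (D k) by apply/funext => x; rewrite /component mxE.
have Lc' : L2v Om c' by move=> k; rewrite c'E; apply: (L2_glue Om_domain) => K; exact: sD.
exists c'; split => //.
  move=> K KM; have [p [q [_ _ ps qs ZE]]] := ZP K KM.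
  exists p, q; split => // x xK; rewrite -ZE; apply/rowP => k.
  by rewrite mxE (glueE M_Om _ KM xK).
move=> c cz w Lw sw; have [Lc _] := cz.
rewrite !ipvE//; apply: eq_bigr => k _; rewrite c'E.
apply: (weak_glue Om_domain M_Om) => //; first by move=> K; exact: sD.
move=> K phi KM tphi; have [_ [_ [sZ zZ _ _ _]]] := ZP K KM.
exact: (local_curl k cz Lz KM sZ zZ tphi).
Qed.

End Curl.

(** * The discrete spaces and the evolution of the magnetic field *)

Section Spaces.
Context {R : realType} (M : mesh R) (Om : set 'rV[R]_3).
Hypotheses (Om_domain : bounded_domain Om) (M_Om : triangulation M Om).
Implicit Types (x : 'rV[R]_3) (f g h phi : 'rV[R]_3 -> R)
  (u v w z : 'rV[R]_3 -> 'rV[R]_3) (K : {set 'I_(nvtx M)}) (i j k : 'I_3).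

Let oOm : open Om. Proof. by case: Om_domain. Qed.
Let bOm : bounded_set Om. Proof. by case: Om_domain. Qed.

Lemma U_div_L2v s u : U_div Om M s u -> L2v Om u.
Proof. by move=> [[]]. Qed.

Lemma U_div_rt s u : U_div Om M s u -> raviart_thomas M s u.
Proof. by move=> []. Qed.

Lemma U_div_pwsmooth s u : U_div Om M s u -> forall i, pwsmooth M (component u i).
Proof.
move=> /U_div_rt uRT i K KM; have [P [sP uP _]] := raviart_thomas_div uRT KM.
by exists (P i); [exact: sP|exact: uP].
Qed.

Lemma testfun_smooth f (A : set 'rV[R]_3) : testfun A f -> smooth f.
Proof. by case. Qed.

Lemma ipv0l v : ipv Om (fun=> 0) v = 0.
Proof.
rewrite /ipv /volint /Rintegral integral0_eq// => c _.
by rewrite /dot big1// => i _; rewrite mxE mul0r.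
Qed.

Lemma L2v0 : L2v Om (fun=> 0).
Proof.
move=> i; rewrite (_ : component _ i = fun=> 0); first exact: L2_0.
by apply/funext => x; rewrite /component mxE.
Qed.

Lemma U_div_comb s (a : R) u v : U_div Om M s u -> U_div Om M s v ->
  U_div Om M s (fun x => a *: u x + v x).
Proof.
move=> uU vU; have Lu := U_div_L2v uU; have Lv := U_div_L2v vU.
have Lau : L2v Om (fun x => a *: u x) by exact: L2vZ.
move: uU vU => [[_ [d [[Ld dP] d_bd]]] uRT] [[_ [d' [[Ld' dP'] d_bd']]] vRT].
split.
  split; first exact: L2vD.
  have Lad : L2 Om (fun x => a * d x) by exact: L2Z.
  exists (fun x => a * d x + d' x); split; first split.
  - exact: L2D.
  - move=> phi tphi; have sphi := testfun_smooth tphi.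
    have Lphi : L2 Om phi by exact: L2_smooth.
    have Lg := L2v_grad Om_domain sphi.
    by rewrite ipvDl// ipvZl// ipDl// ipZl// dP// dP'//; ring.
  - move=> phi sphi.
    have Lphi : L2 Om phi by exact: L2_smooth.
    have Lg := L2v_grad Om_domain sphi.
    rewrite ipvDl// ipvZl// ipDl// ipZl//.
    rewrite addrACA -mulrDr d_bd// d_bd'//; ring.
move=> K KM; have [p [q [ps qs uE]]] := uRT K KM.
have [p' [q' [ps' qs' vE]]] := vRT K KM.
exists (fun x => a *: p x + p' x), (fun x => a * q x + q' x); split.
- move=> i; rewrite (_ : component _ i = fun x => a * component p i x + component p' i x).
    by apply: polyfunD => //; exact: polyfunZ.
  by apply/funext => x; rewrite /component !mxE.
- by apply: polyfunD => //; exact: polyfunZ.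
- move=> x xK; rewrite uE// vE// scalerDr scalerDl scalerA; exact: addrACA.
Qed.

Lemma U_curl0 s : U_curl Om M s (fun=> 0).
Proof.
have Z0 : component (fun=> 0 : 'rV[R]_3) = fun _ _ => 0.
  by apply/funext => i; apply/funext => x; rewrite /component mxE.
split.
  split; first exact: L2v0.
  exists (fun=> 0); split; first split; first exact: L2v0.
  - by move=> phi _; rewrite !ipv0l.
  - by move=> phi _; rewrite !ipv0l subrr.
move=> K _; exists (fun=> 0), (fun=> 0); split.
- by move=> i; rewrite Z0; exact: polyfun0.
- by move=> i; rewrite Z0; exact: polyfun0.
- by move=> x _; apply/rowP => i; rewrite !mxE !mulr0 subrr addr0.
Qed.

(** Whether or not the projection exists, [L2projv] returns an element of [U_curl],
since its default value is the zero field. *)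
Lemma L2projv_U_curl s v : U_curl Om M s (L2projv Om (U_curl Om M s) v).
Proof.
rewrite /L2projv; set S := [set w | _].
have [[w Sw]|nS] := pselect (exists w, S w).
  by have [] := xgetPex (fun=> 0) (ex_intro _ w Sw).
by rewrite xgetPN; [exact: U_curl0|move=> w Sw; apply: nS; exists w].
Qed.

Lemma wdivP s u : U_div Om M s u -> is_wdiv Om u (wdiv Om u).
Proof.
by move=> [[_ [d [dP _]]] _]; exact: (xgetPex (fun=> 0) (ex_intro _ d dP)).
Qed.

Lemma wcurlP s z : U_curl Om M s z -> is_wcurl Om z (wcurl Om z).
Proof.
by move=> [[_ [c [cP _]]] _]; exact: (xgetPex (fun=> 0) (ex_intro _ c cP)).
Qed.

(** The divergence is piecewise polynomial of degree at most [s], and its mean is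
zero by the vanishing normal trace, tested with the constant 1. Hence it belongs
to [Q_h] and, being orthogonal to [Q_h], to itself. *)
Lemma U_div_divfree s u : U_div Om M s u ->
  (forall q, Q_h Om M s q -> ip Om (wdiv Om u) q = 0) -> is_wdiv Om u (fun=> 0).
Proof.
move=> uU incomp; have Lu := U_div_L2v uU.
have [dp [Ldp pdp dpE]] := weak_div_pwpoly Om_domain M_Om Lu (U_div_rt uU).
have wd := wdivP uU.
have s1 : smooth (fun=> 1 : R) := smooth_cst (1 : R).
have L1 : L2 Om (fun=> 1) by exact: L2_smooth.
have mean0 : volint Om dp = 0.
  have -> : volint Om dp = ip Om dp (fun=> 1).
    by apply: eq_Rintegral => c _; rewrite mulr1.
  have [[_ [d [dP bd]]] _] := uU.
  rewrite -(dpE d dP)//; last by move=> K _; exists (fun=> 1).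
  have := bd _ s1; rewrite ipvC.
  rewrite (_ : grad (fun=> 1) = fun=> 0) ?ipv0l ?add0r//.
  by apply/funext => x; apply/rowP => i; rewrite !mxE partial_cst.
(* The incompressibility equation is used with the test function [dp]. *)
have dp0 : ip Om dp dp = 0.
  rewrite -(dpE _ wd)//; last exact: pwpoly_smooth pdp.
  by apply: incomp; split.
split; first exact: L2_0.
move=> phi tphi; have sphi := testfun_smooth tphi.
have [_ ->//] := wd.
rewrite (dpE _ wd); [|exact: L2_smooth|by move=> K _; exists phi].
by rewrite ip0l (ip_null Ldp _ dp0)//; exact: L2_smooth.
Qed.

(** [curl grad = 0] gives both the vanishing divergence and the vanishing normal
trace of the curl. The latter is why the curl can serve as a test function in the
induction equation. *)
Lemma U_curl_curl s z : U_curl Om M s z -> exists c,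
  [/\ U_div Om M s c, is_wdiv Om c (fun=> 0) &
      forall w, U_div Om M s w -> ipv Om (wcurl Om z) w = ipv Om c w].
Proof.
move=> zU; have [[Lz [c1 [c1P c1bd]]] zN] := zU.
have wz := wcurlP zU.
have [c [Lc cRT cE]] := weak_curl_raviart_thomas Om_domain M_Om Lz zN.
have orth phi : smooth phi -> ipv Om c (grad phi) = 0.
  move=> sphi; have sg i := smooth_grad i sphi.
  rewrite -(cE c1 c1P); [|exact: L2v_grad|by move=> i K _; exists (component (grad phi) i)].
  have /eqP := c1bd (grad phi) sg.
  by rewrite curl_grad// ipvC ipv0l sub0r oppr_eq0 => /eqP.
have wc : is_wdiv Om c (fun=> 0).
  split; first exact: L2_0.
  by move=> phi /testfun_smooth sphi; rewrite orth// ip0l oppr0.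
exists c; split => //.
  split => //; split => //; exists (fun=> 0); split => // phi sphi.
  by rewrite orth// ip0l addr0.
move=> w wU; apply: cE => //; first exact: U_div_L2v wU.
exact: U_div_pwsmooth wU.
Qed.

End Spaces.

Section Evolution.
Context {R : realType} (M : mesh R) (Om : set 'rV[R]_3).
Hypotheses (Om_domain : bounded_domain Om) (M_Om : triangulation M Om).
Variables (s : nat) (T : R) (B : R -> 'rV[R]_3 -> 'rV[R]_3).
Hypotheses (T_gt0 : 0 < T)
  (B_U : forall t, 0 <= t <= T -> U_div Om M s (B t)) (B_dt : dtv_ex Om T B).

Definition quot t r : 'rV[R]_3 -> 'rV[R]_3 := fun x => (r - t)^-1 *: (B r x - B t x).

Lemma quotE t r : quot t r = fun x => (r - t)^-1 *: B r x + (- (r - t)^-1) *: B t x.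
Proof. by apply/funext => x; rewrite /quot scalerBr scaleNr. Qed.

Lemma dtv_L2v t : 0 <= t <= T -> L2v Om (dtv Om T B t).
Proof.
move=> tT i; have [v vP] := B_dt tT.
by have [] := xgetPex (fun=> 0) (ex_intro _ v vP) i.
Qed.

Lemma L2v_quot t r : 0 <= t <= T -> 0 <= r <= T -> L2v Om (quot t r).
Proof.
move=> tT rT; have Lt := U_div_L2v (B_U tT); have Lr := U_div_L2v (B_U rT).
by rewrite quotE; apply: L2vD; exact: L2vZ.
Qed.

Lemma quot_cvg t w : 0 <= t <= T -> L2v Om w ->
  ipv Om (quot t r) w @[r --> interval_dnbhs T t] --> ipv Om (dtv Om T B t) w.
Proof.
move=> tT Lw.
have FF := interval_dnbhs_proper T_gt0 tT.
apply: ipv_cvg => //; first exact: dtv_L2v.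
  by apply: filterS (withinT _ _) => r rT; exact: L2v_quot.
move=> i; have [v vP] := B_dt tT.
have [_] := xgetPex (fun=> 0) (ex_intro _ v vP) i.
rewrite (_ : (fun r => L2norm Om (fun x =>
      (r - t)^-1 * (component (B r) i x - component (B t) i x)
    - component (xget (fun=> 0) _) i x)) =
  (fun r => L2norm Om (fun x => component (quot t r) i x - component (dtv Om T B t) i x)))//.
apply/funext => r; congr (L2norm Om _); apply/funext => x.
by rewrite /quot /component !mxE.
Qed.

(** The residual [e = dB/dt + c] is orthogonal to [U_div], which contains the
difference quotients of [B] and [c]. In the limit [e] is orthogonal to [dB/dt + c],
that is, to itself. *)
Lemma induction_strong t c : 0 <= t <= T -> U_div Om M s c ->
  (forall C, U_div Om M s C -> ipv Om (dtv Om T B t) C + ipv Om c C = 0) ->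
  forall w, L2v Om w -> ipv Om (dtv Om T B t) w = - ipv Om c w.
Proof.
move=> tT cU weak w Lw.
have FF := interval_dnbhs_proper T_gt0 tT.
have LB := dtv_L2v tT; have Lc := U_div_L2v cU; have BtU := B_U tT.
pose e x := dtv Om T B t x + c x.
have Le : L2v Om e by exact: L2vD.
have e_orth C : U_div Om M s C -> ipv Om e C = 0.
  by move=> CU; rewrite ipvDl//; [exact: weak|exact: U_div_L2v CU].
have quotU r : 0 <= r <= T -> U_div Om M s (fun x => quot t r x + c x).
  move=> rT; rewrite (_ : (fun x => _) = fun x =>
      (r - t)^-1 *: B r x + (- (r - t)^-1 *: B t x + c x)).
    by apply: U_div_comb => //; [exact: B_U|exact: U_div_comb].
  by apply/funext => x; rewrite quotE addrA.
(* Test with [quot t r + c] and let [r] tend to [t]. *)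
have lim0 : ipv Om (dtv Om T B t) e = - ipv Om c e.
  have C1 := quot_cvg tT Le.
  have C2 : ipv Om (quot t r) e @[r --> interval_dnbhs T t] --> - ipv Om c e.
    apply: cvg_near_cst; apply: filterS (withinT _ _) => r rT.
    have := e_orth _ (quotU r rT).
    rewrite ipvC ipvDl//; last exact: L2v_quot.
    by move=> /eqP; rewrite addr_eq0 => /eqP.
  exact: (cvg_unique _ C1 C2).
have ee0 : ipv Om e e = 0 by rewrite {1}/e ipvDl// lim0 addNr.
have := ipv_null Le Lw ee0; rewrite ipvDl// => /eqP; rewrite addr_eq0 => /eqP.
exact.
Qed.

(** For a test function [phi], the derivative of [(B, grad phi)] is
[- (c, grad phi) = 0]. *)
Lemma divfree_preserved :
  (forall t, 0 <= t <= T -> exists c, [/\ U_div Om M s c, is_wdiv Om c (fun=> 0) &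
    forall C, U_div Om M s C -> ipv Om (dtv Om T B t) C + ipv Om c C = 0]) ->
  is_wdiv Om (B 0) (fun=> 0) ->
  forall t, 0 <= t <= T -> is_wdiv Om (B t) (fun=> 0).
Proof.
move=> strong [_ B00] t tT; split; first exact: L2_0.
move=> phi tphi; have sphi := testfun_smooth tphi.
have Lg := L2v_grad Om_domain sphi.
rewrite -(B00 phi tphi).
apply: (derivative0_cst (G := fun r => ipv Om (B r) (grad phi)) (T := T)) => // {t tT} t tT.
have [c [cU [_ c0] weak]] := strong t tT.
have FF := interval_dnbhs_proper T_gt0 tT.
have <- : ipv Om (dtv Om T B t) (grad phi) = 0.
  by rewrite (induction_strong tT cU weak)// c0// ip0l !oppr0.
have E : \forall r \near interval_dnbhs T t,
    ipv Om (quot t r) (grad phi) =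
    (r - t)^-1 * (ipv Om (B r) (grad phi) - ipv Om (B t) (grad phi)).
  apply: filterS (withinT _ _) => r rT.
  have Lt := U_div_L2v (B_U tT); have Lr := U_div_L2v (B_U rT).
  rewrite quotE ipvDl//; [|exact: L2vZ..].
  by rewrite !ipvZl//; ring.
apply: (cvg_trans (near_eq_cvg E)); exact: quot_cvg.
Qed.

End Evolution.

Theorem proposition3p1 (R : realType) (Om : set 'rV[R]_3) (M : mesh R)
  (s m : nat) (T : R)
  (u B : R -> 'rV[R]_3 -> 'rV[R]_3) (rho p : R -> 'rV[R]_3 -> R)
  (Om_domain : bounded_domain Om) (M_Om : triangulation M Om) (T_gt0 : 0 < T)
  (u_U : forall t : R, 0 <= t <= T -> U_div Om M s (u t))
  (B_U : forall t : R, 0 <= t <= T -> U_div Om M s (B t))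
  (rho_F : forall t : R, 0 <= t <= T -> F_h Om M m (rho t))
  (p_Q : forall t : R, 0 <= t <= T -> Q_h Om M s (p t))
  (u_dt : dtv_ex Om T u) (B_dt : dtv_ex Om T B) (rho_dt : dt_ex Om T rho)
  (rhou_dt : dtv_ex Om T (fun t x => rho t x *: u t x))
  (momentum : forall t : R, 0 <= t <= T -> forall v, U_div Om M s v ->
     ipv Om (dtv Om T (fun r x => rho r x *: u r x) t) v
     + a_h Om M s (fun x => rho t x *: u t x) (u t) v
     - a_h Om M s (B t) (B t) v
     + 2^-1 * b_h Om M m (fun x => dot (u t x) (u t x)) (rho t) v
     = ip Om (p t) (wdiv Om v))
  (induction : forall t : R, 0 <= t <= T -> forall C, U_div Om M s C ->
     ipv Om (dtv Om T B t) C + a_h Om M s C (B t) (u t) = 0)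
  (continuity : forall t : R, 0 <= t <= T -> forall sigma, F_h Om M m sigma ->
     ip Om (dt Om T rho t) sigma + b_h Om M m sigma (rho t) (u t) = 0)
  (incompressibility : forall t : R, 0 <= t <= T -> forall q, Q_h Om M s q ->
     ip Om (wdiv Om (u t)) q = 0) :
  (forall t : R, 0 <= t <= T -> is_wdiv Om (u t) (fun=> 0)) /\
  (is_wdiv Om (B 0) (fun=> 0) ->
   forall t : R, 0 <= t <= T -> is_wdiv Om (B t) (fun=> 0)).
Proof.
split=> [t tT|].
  exact: (U_div_divfree Om_domain M_Om (u_U t tT) (incompressibility t tT)).
apply: (divfree_preserved Om_domain T_gt0 B_U B_dt) => t tT.
have [c [cU c0 cE]] := U_curl_curl Om_domain M_Om
  (L2projv_U_curl M Om s (fun x => cross (B t x) (u t x))).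
exists c; split => // C CU; rewrite -cE//.
by have := induction t tT C CU; rewrite /a_h [ipv Om C _]ipvC.
Qed.
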